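(* Let $m$ be an odd positive integer, let $n$ and $d$ be positive integers with $m<d$, and let $b$ be a real number with $b\notin \mathbb{Z}/d$. Put $p_1=e^{-\pi i m(b-1)}$, $p_2=e^{-2\pi i db}$, $p_1'=e^{\pi i m(b-1)}$ and $p_2'=e^{2\pi i db}$. Then $$\sum_{j=0}^{d-1} \cos\Big(\frac{\pi mj}{d}\Big)\csc^{2n-1}\Big(\frac{\pi j}{d}+\pi b\Big) = -\sum i^{\mu+\nu+1}\,2^{\nu}\,\frac{m^\mu}{\mu!}\,\frac{d^{\nu+1}}{\nu!}\Big(p_1 A_\nu(p_2)-(-1)^{\mu+\nu}p_1' A_\nu(p_2')\Big)F(j_1,\ldots,j_{2n-1}),$$ where the sum on the right is over all nonnegative integers $j_1,\ldots,j_{2n-1},\mu,\nu$ such that $2j_1+\cdots+2j_{2n-1}+\mu+\nu=2n-2$ (so that $\mu+\nu$ is even).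
   Context: Here $i$ is the imaginary unit, $\csc$ denotes the cosecant, and $\mathbb{Z}/d=\{k/d : k\in\mathbb{Z}\}$. For a complex number $t\neq 1$, the numbers $A_\nu(t)$, $\nu\ge 0$, are defined by the power series expansion about $z=0$: $\frac{1}{te^z-1}=\sum_{\nu=0}^{\infty}\frac{A_\nu(t)}{\nu!}z^\nu$ (e.g. $A_0(t)=\frac{1}{t-1}$, $A_1(t)=\frac{-t}{(t-1)^2}$). For $j\ge 0$, $G_j=\frac{(-1)^j\,2(2^{2j-1}-1)B_{2j}}{(2j)!}$, where $B_k$ are the Bernoulli numbers ($\frac{x}{e^x-1}=\sum_{k\ge 0}B_k\frac{x^k}{k!}$); thus $G_0=-1$, $G_1=-\frac16$, $G_2=-\frac{7}{360}$, and these are the coefficients in $-\csc(\pi w)=\sum_{j\ge 0}G_j\pi^{2j-1}w^{2j-1}$ near $w=0$. Finally $F(j_1,\ldots,j_{N})=\prod_{r=1}^{N}G_{j_r}$. *)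

(* Defs.v *)
From HB Require Import structures.
From mathcomp Require Import all_boot all_order all_algebra.
From mathcomp Require Import all_classical all_reals all_analysis.
From mathcomp Require Import complex.
Set Implicit Arguments.
Unset Strict Implicit.
Unset Printing Implicit Defensive.
Import Order.TTheory GRing.Theory Num.Theory.
Import numFieldNormedType.Exports.
Local Open Scope classical_set_scope.
Local Open Scope ring_scope.
Local Open Scope complex_scope.

Definition egf_expansion (K : numFieldType) (f : K -> K) (a : nat -> K) :=
  \forall z \near (0 : K),
    series (fun k : nat => a k / (k`!)%:R * z ^+ k) @ \oo --> f z.

(* [xget] returns the sequence satisfying the predicate; it is unique by the
   identity theorem for power series.  The default value 0 is only reached if
   f has no power series expansion about 0. *)
Definition egf_coef (K : numFieldType) (f : K -> K) : nat -> K :=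
  xget (fun=> 0) [set a | egf_expansion f a].

Definition bernoulli_number (R : realType) : nat -> R :=
  egf_coef (fun x : R => if x == 0 then 1 else x / (expR x - 1)).

(* The exponent is an integer, so that the factor is 2^(-1) - 1 at j = 0. *)
Definition G (R : realType) (j : nat) : R :=
  (- 1) ^+ j * 2 * (2 ^ ((2 * j)%:Z - 1) - 1) * bernoulli_number R (2 * j)
  / ((2 * j)`!)%:R.

Definition F (R : realType) (N : nat) (j : 'I_N -> nat) : R :=
  \prod_(r < N) G R (j r).

Definition csc (R : realType) (x : R) : R := (sin x)^-1.

Definition cexp (R : realType) (z : R[i]) : R[i] :=
  let: x +i* y := z in (expR x)%:C * (cos y +i* sin y).

Definition A (R : realType) (nu : nat) (t : R[i]) : R[i] :=
  egf_coef (fun z : R[i] => (t * cexp z - 1)^-1) nu.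

(* Main.v *)
Require Import Defs.
From HB Require Import structures.
From mathcomp Require Import all_boot all_order all_algebra.
From mathcomp Require Import all_classical all_reals all_analysis.
From mathcomp Require Import complex ring zify.
Set Implicit Arguments.
Unset Strict Implicit.
Unset Printing Implicit Defensive.
Import Order.TTheory GRing.Theory Num.Theory.
Import numFieldNormedType.Exports.
Local Open Scope ring_scope.
Local Open Scope complex_scope.

(** Write x_j = pi j / d + pi b and N = 2n - 1.  The proof rests on two facts
    about cosecants and one about generating functions.

    First, csc^N x is the residue at w = 0 of csc^N w csc (x - w) for odd N
    ([csc_residue]).  With D(w) = w / sin w this says that csc^N x is the
    coefficient of w^(N-1) in the power series D(w)^N csc (x - w).  It is proved
    by induction on N: multiplying the function by csc^2 w - csc^2 x leaves only
    terms csc^(N+1) w cot w and csc^(N+1) w, whose residues vanish because the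
    first is a derivative and the second is even.

    Second, the case n = 1 with b shifted by a variable is an identity of
    rational functions in q = e^(i (pi b - w)): the sum over j of
    cos (pi m j / d) csc (x_j - w) has summands over q^2 z^j - 1, with z a
    primitive d-th root of unity, and expanding these as geometric sums over
    the common denominator q^(2d) - 1 collapses the sum over j
    ([partial_fractions], [csc_sum_series]).  The outcome is
      i d (p1 e^(imw) / (p2 e^(2idw) - 1) - p1' e^(-imw) / (p2' e^(-2idw) - 1)).

    Hence the left-hand side of the theorem is the coefficient of w^(N-1) in
    D(w)^N times this expression.  Since D(w) = - sum_j G_j w^(2j)
    ([G_wcscE]) and the expansion coefficients of 1 / (p2 e^(2idw) - 1) are
    (2id)^nu A_nu(p2) / nu!, expanding the product gives the right-hand side
    ([csc_power_sum]).

    All of this is done with formal power series.  Analysis enters only to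
    identify the numbers A_nu(t) and B_k, defined through convergent expansions,
    with the coefficients of formal reciprocals: expansions are unique
    ([expansion_unique]), and a formal reciprocal converges to the reciprocal of
    the function ([expansion_inv]). *)

(** * Formal power series *)

(** A wrapper around sequences, so that the product is convolution and not the
    pointwise product that functions into a ring carry. *)
Definition fps (K : Type) := nat -> K.

Section FpsRing.
Variable K : fieldType.
Implicit Types f g h : fps K.

HB.instance Definition _ := GRing.Zmodule.copy (fps K) (nat -> K).

Lemma fpsDE f g n : (f + g) n = f n + g n. Proof. by []. Qed.
Lemma fpsNE f n : (- f) n = - f n. Proof. by []. Qed.
Lemma fpsBE f g n : (f - g) n = f n - g n. Proof. by []. Qed.
Lemma fps_sumE I (r : seq I) (P : pred I) (f : I -> fps K) n :
  (\sum_(i <- r | P i) f i) n = \sum_(i <- r | P i) f i n.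
Proof. by elim/big_rec2: _ => // i x y _ <-. Qed.

Definition fpsC (c : K) : fps K := fun n => if n is 0%N then c else 0.
Definition fps_mul f g : fps K := fun n => \sum_(i < n.+1) f i * g (n - i)%N.
Definition fps_trunc n f : {poly K} := \poly_(i < n) f i.

Lemma coef_fps_trunc n f i : (i < n)%N -> (fps_trunc n f)`_i = f i.
Proof. by rewrite coef_poly => ->. Qed.

(** The ring laws are inherited from polynomials through truncation. *)
Lemma coef_fps_truncM m f g n : (n < m)%N ->
  (fps_trunc m f * fps_trunc m g)`_n = fps_mul f g n.
Proof.
move=> nm; rewrite coefM; apply: eq_bigr => i _.
by rewrite !coef_fps_trunc// ?(leq_ltn_trans (leq_subr _ _) nm)//
  (leq_ltn_trans _ nm)// -ltnS.
Qed.

Fact fps_mulC : commutative fps_mul.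
Proof. by move=> f g; apply/funext => n; rewrite -!(@coef_fps_truncM n.+1)// mulrC. Qed.

Fact fps_mulA : associative fps_mul.
Proof.
move=> f g h; apply/funext => n.
transitivity ((fps_trunc n.+1 f * (fps_trunc n.+1 g * fps_trunc n.+1 h))`_n).
  rewrite coefM; apply: eq_bigr => -[i /= iN] _.
  by rewrite coef_fps_trunc// coef_fps_truncM// ltnS leq_subr.
rewrite mulrA coefM; apply: eq_bigr => -[i /= iN] _.
by rewrite coef_fps_trunc ?ltnS ?leq_subr// coef_fps_truncM.
Qed.

Fact fps_mul1 : left_id (fpsC 1) fps_mul.
Proof.
move=> f; apply/funext => n; rewrite /fps_mul big_ord_recl subn0 mul1r.
by rewrite big1 ?addr0// => i _; rewrite mul0r.
Qed.

Fact fps_mulDl : left_distributive fps_mul +%R.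
Proof.
move=> f g h; apply/funext => n; rewrite fpsDE /fps_mul -big_split /=.
by apply: eq_bigr => i _; rewrite mulrDl.
Qed.

Fact fps1_neq0 : fpsC 1 != 0.
Proof. by apply/eqP => /(congr1 (@^~ 0%N)); apply/eqP/oner_neq0. Qed.

HB.instance Definition _ := GRing.Zmodule_isComNzRing.Build (fps K)
  fps_mulA fps_mulC fps_mul1 fps_mulDl fps1_neq0.

Lemma fpsME f g n : (f * g) n = \sum_(i < n.+1) f i * g (n - i)%N.
Proof. by []. Qed.

Lemma fps1E n : (1 : fps K) n = (n == 0%N)%:R.
Proof. by case: n. Qed.

Lemma fpsC_is_additive : additive fpsC.
Proof. by move=> a b; apply/funext => -[|n]//=; rewrite fpsBE /= subr0. Qed.

Lemma fpsCM0 c f n : (fpsC c * f) n = c * f n.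
Proof.
rewrite fpsME big_ord_recl subn0 big1 ?addr0// => i _; exact: mul0r.
Qed.

Lemma fpsC_is_multiplicative : multiplicative fpsC.
Proof.
split=> // a b; apply/funext => n; rewrite fpsCM0.
by case: n => //= n; rewrite mulr0.
Qed.

HB.instance Definition _ := GRing.isAdditive.Build K (fps K) fpsC
  fpsC_is_additive.
HB.instance Definition _ := GRing.isMultiplicative.Build K (fps K) fpsC
  fpsC_is_multiplicative.

Lemma fps_mul0E f g : (f * g) 0%N = f 0%N * g 0%N.
Proof. by rewrite fpsME big_ord1. Qed.

Lemma fps_exp0E f k : (f ^+ k) 0%N = f 0%N ^+ k.
Proof. by elim: k => [|k IH]; rewrite ?expr0 // !exprS fps_mul0E IH. Qed.

(** The first n coefficients of the reciprocal, as a list: each coefficient is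
    solved from all the previous ones, which recursion on n alone cannot
    reach. *)
Fixpoint fps_inv_prefix f n : seq K :=
  if n is n'.+1 then
    let s := fps_inv_prefix f n' in
    rcons s (if n' is 0%N then (f 0%N)^-1
             else - ((f 0%N)^-1 * \sum_(i < n') f i.+1 * s`_(n' - i.+1)))
  else [::].

Definition fps_unit : pred (fps K) := fun f => f 0%N != 0.
Definition fps_inv f : fps K :=
  if fps_unit f then fun n => (fps_inv_prefix f n.+1)`_n else f.

Lemma size_fps_inv_prefix f n : size (fps_inv_prefix f n) = n.
Proof. by elim: n => //= n IH; rewrite size_rcons IH. Qed.

Lemma nth_fps_inv_prefix f n i : (i < n)%N ->
  (fps_inv_prefix f n)`_i = (fps_inv_prefix f i.+1)`_i.
Proof.
elim: n => // n IH; rewrite ltnS leq_eqVlt => /predU1P[->//|iN].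
by rewrite [LHS]/= nth_rcons size_fps_inv_prefix iN IH.
Qed.

Lemma fps_invS f n : fps_unit f -> fps_inv f n.+1 =
  - ((f 0%N)^-1 * \sum_(i < n.+1) f i.+1 * fps_inv f (n - i)%N).
Proof.
rewrite /fps_inv => ->.
rewrite -[fps_inv_prefix f n.+2]/(rcons (fps_inv_prefix f n.+1) _).
rewrite nth_rcons size_fps_inv_prefix ltnn eqxx.
congr (- (_ * _)); apply: eq_bigr => i _; congr (_ * _).
by rewrite subSS (@nth_fps_inv_prefix _ n.+1)// ltnS leq_subr.
Qed.

Fact fps_mulVr : {in fps_unit, left_inverse 1 fps_inv *%R}.
Proof.
move=> f f0; have fU : fps_unit f by [].
apply/funext => -[|n]; rewrite mulrC.
  by rewrite fps_mul0E /fps_inv fU /= mulfV.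
rewrite fpsME big_ord_recl subn0 fps_invS// mulrN mulVKf//.
by apply/eqP; rewrite addrC subr_eq0; apply/eqP/eq_bigr => i _; rewrite subSS.
Qed.

Fact fps_unitPl f g : g * f = 1 -> fps_unit f.
Proof.
move=> /(congr1 (@^~ 0%N)); rewrite fps_mul0E fps1E /= => gf.
by apply/eqP => f0; move: gf; rewrite f0 mulr0 => /esym/eqP; rewrite oner_eq0.
Qed.

Fact fps_inv_out : {in [predC fps_unit], fps_inv =1 id}.
Proof.
move=> f fN; have /negbTE fU : ~~ fps_unit f by [].
by rewrite /fps_inv fU.
Qed.

HB.instance Definition _ := GRing.ComNzRing_hasMulInverse.Build (fps K)
  fps_mulVr fps_unitPl fps_inv_out.

Lemma fps_unitE f : (f \is a GRing.unit) = (f 0%N != 0).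
Proof. by []. Qed.

Lemma fps_invE f : f^-1 = fps_inv f. Proof. by []. Qed.

Lemma fps_inv0E f : f 0%N != 0 -> f^-1 0%N = (f 0%N)^-1.
Proof. by move=> fU; rewrite fps_invE /fps_inv /fps_unit fU. Qed.

Definition fpsX : fps K := fun n => (n == 1%N)%:R.

Lemma fpsXM0 f : (fpsX * f) 0%N = 0.
Proof. by rewrite fps_mul0E mul0r. Qed.

Lemma fpsXMS f n : (fpsX * f) n.+1 = f n.
Proof.
rewrite fpsME big_ord_recl big_ord_recl /fpsX /= mul0r mul1r add0r big1 ?addr0.
  by rewrite subSS subn0.
by move=> i _; rewrite mul0r.
Qed.

Lemma fpsX_inj : injective (fun f => fpsX * f).
Proof.
move=> f g fg; apply/funext => n.
by rewrite -!(fpsXMS _ n) fg.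
Qed.

(** w d/dw, a derivation that keeps every coefficient in its place. *)
Definition fps_euler f : fps K := fun n => n%:R * f n.

Lemma fps_eulerM f g :
  fps_euler (f * g) = fps_euler f * g + f * fps_euler g.
Proof.
apply/funext => n; rewrite fpsDE /fps_euler !fpsME mulr_sumr -big_split /=.
apply: eq_bigr => i _.
have -> : n%:R = i%:R + (n - i)%:R :> K.
  by rewrite -natrD subnKC// -ltnS.
by ring.
Qed.

Lemma fps_euler1 : fps_euler 1 = 0.
Proof. by apply/funext => -[|n]; rewrite /fps_euler ?mul0r// mulr0. Qed.

Lemma fps_eulerX f k : fps_euler (f ^+ k.+1) = f ^+ k * fps_euler f *+ k.+1.
Proof.
elim: k => [|k IH]; first by rewrite expr1 expr0 mul1r.
by rewrite exprS fps_eulerM IH exprS; ring.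
Qed.

(** f (c w) *)
Definition fps_scale c f : fps K := fun n => c ^+ n * f n.

Lemma fps_scale_is_additive c : additive (fps_scale c).
Proof. by move=> f g; apply/funext => n; rewrite /fps_scale !fpsBE mulrBr. Qed.

Lemma fps_scale_is_multiplicative c : multiplicative (fps_scale c).
Proof.
split=> [f g|]; apply/funext => n; last first.
  by rewrite /fps_scale; case: n => [|n]; rewrite ?mul1r// !fps1E mulr0.
rewrite /fps_scale !fpsME mulr_sumr; apply: eq_bigr => i _.
have -> : c ^+ n = c ^+ i * c ^+ (n - i) by rewrite -exprD subnKC// -ltnS.
by ring.
Qed.

HB.instance Definition _ c := GRing.isAdditive.Build (fps K) (fps K)
  (fps_scale c) (fps_scale_is_additive c).
HB.instance Definition _ c := GRing.isMultiplicative.Build (fps K) (fps K)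
  (fps_scale c) (fps_scale_is_multiplicative c).

Lemma fps_scaleC c a : fps_scale c (fpsC a) = fpsC a.
Proof. by apply/funext => -[|n]; rewrite /fps_scale ?mul1r//= mulr0. Qed.

Lemma fps_scaleX c : fps_scale c fpsX = fpsC c * fpsX.
Proof.
apply/funext => n; rewrite fpsCM0 /fps_scale /fpsX.
by case: n => [|[|n]]; rewrite ?mulr0.
Qed.

Lemma fps_even_odd0 f : (2 : K) != 0 -> fps_scale (-1) f = f ->
  forall n, odd n -> f n = 0.
Proof.
move=> n2 fe n on; have := congr1 (@^~ n) fe; rewrite /fps_scale.
rewrite -signr_odd on expr1 mulN1r => /eqP; rewrite eq_sym -addr_eq0 -mulr2n.
by rewrite -mulr_natl mulf_eq0 (negbTE n2) => /eqP.
Qed.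

End FpsRing.

Arguments fpsX {K}.

(** * Exponential and circular series *)

Section FpsExp.
Variable K : numFieldType.
Implicit Types (a b c sx cx : K) (k n : nat).

Lemma fact_neq0 n : (n`!%:R : K) != 0.
Proof. by rewrite pnatr_eq0 -lt0n fact_gt0. Qed.

Definition fps_exp c : fps K := fun n => c ^+ n / n`!%:R.

Lemma fps_exp_0 : fps_exp 0 = 1.
Proof.
by apply/funext => -[|n]; rewrite /fps_exp fps1E ?divr1// expr0n mul0r.
Qed.

Lemma fps_expD a b : fps_exp (a + b) = fps_exp a * fps_exp b.
Proof.
apply/funext => n; rewrite mulrC /fps_exp fpsME addrC addrC exprDn mulr_suml.
rewrite [LHS](reindex_inj rev_ord_inj) [RHS](reindex_inj rev_ord_inj) /=.
apply: eq_bigr => -[i /= iN] _; rewrite !subSS subKn//.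
rewrite -mulr_natr -(@bin_fact n (n - i)) ?leq_subr// !natrM subKn//.
have := fact_neq0 i; have := fact_neq0 (n - i).
have : ('C(n, n - i)%:R : K) != 0.
  by rewrite pnatr_eq0 -lt0n bin_gt0 leq_subr.
by move=> *; field; apply/and3P; split.
Qed.

Lemma fps_expMn c k : fps_exp c ^+ k = fps_exp (c * k%:R).
Proof.
elim: k => [|k IH]; first by rewrite expr0 mulr0 fps_exp_0.
by rewrite exprS IH -fps_expD -natr1; congr fps_exp; ring.
Qed.

Lemma fps_expNK c : fps_exp c * fps_exp (- c) = 1.
Proof. by rewrite -fps_expD subrr fps_exp_0. Qed.

Lemma fps_scale_exp a c : fps_scale a (fps_exp c) = fps_exp (a * c).
Proof. by apply/funext => n; rewrite /fps_scale /fps_exp exprMn mulrA. Qed.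

Lemma fpsCX_inj c : c != 0 -> injective (fun f => fpsC c * fpsX * f).
Proof.
move=> c0 f g; rewrite -!mulrA => /(congr1 ( *%R (fpsC c^-1))).
by rewrite !mulrA -rmorphM /= mulVf// rmorph1 !mul1r => /fpsX_inj.
Qed.

(** (e^w - 1) / w *)
Definition fps_expm1q : fps K := fun n => (n.+1`!%:R)^-1.

Lemma fps_expm1q_unit : fps_expm1q \is a GRing.unit.
Proof. by rewrite fps_unitE /fps_expm1q invr1 oner_neq0. Qed.

Lemma fpsX_expm1q : fpsX * fps_expm1q = fps_exp 1 - 1.
Proof.
apply/funext => -[|n]; rewrite fpsBE fps1E.
  by rewrite fpsXM0 /fps_exp divr1 subrr.
by rewrite fpsXMS /fps_exp expr1n mul1r subr0.
Qed.

Variable im : K.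
Hypothesis im2 : im ^+ 2 = -1.

Let two_neq0 : (2 : K) != 0. Proof. by rewrite pnatr_eq0. Qed.

Lemma im_neq0 : im != 0.
Proof. by rewrite -sqrf_eq0 im2 oppr_eq0 oner_neq0. Qed.

Definition fps_cos : fps K := fpsC 2^-1 * (fps_exp im + fps_exp (- im)).

Lemma fps_cos0 : fps_cos 0%N = 1.
Proof. by rewrite /fps_cos fpsCM0 fpsDE /fps_exp !expr0 !divr1 mulVf. Qed.

(** sin w / w *)
Definition fps_sinc : fps K :=
  fun n => im ^+ n * (1 + (-1) ^+ n) / 2 / n.+1`!%:R.

Lemma fps_sinc0 : fps_sinc 0%N = 1.
Proof. by rewrite /fps_sinc !expr0 mul1r mulfV// divr1. Qed.

Lemma fps_sinc_unit : fps_sinc \is a GRing.unit.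
Proof. by rewrite fps_unitE fps_sinc0 oner_neq0. Qed.

Lemma fpsX_sinc :
  fpsC (2 * im) * fpsX * fps_sinc = fps_exp im - fps_exp (- im).
Proof.
apply/funext => n; rewrite -mulrA fpsCM0 fpsBE; case: n => [|n].
  by rewrite fpsXM0 mulr0 /fps_exp !expr0 subrr.
rewrite fpsXMS /fps_sinc /fps_exp [(- im) ^+ _]exprNn !exprS.
by have := fact_neq0 n.+1 => ?; field.
Qed.

Lemma fps_cosD_sinc2 : fps_cos ^+ 2 + fpsX ^+ 2 * fps_sinc ^+ 2 = 1.
Proof.
have XS : fpsX * fps_sinc = fpsC (2 * im)^-1 * (fps_exp im - fps_exp (- im)).
  rewrite -fpsX_sinc 2!mulrA -rmorphM /= mulVf ?rmorph1 ?mul1r//.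
  by rewrite mulf_neq0// im_neq0.
rewrite -exprMn XS /fps_cos !exprMn -!rmorphXn /=.
have -> : (2 * im)^-1 ^+ 2 = - 2^-1 ^+ 2.
  by rewrite exprVn exprMn im2 mulrN1 invrN exprVn.
have q : fpsC (2^-1 ^+ 2) * 4 = 1 :> fps K.
  rewrite -[X in _ * X](rmorph_nat (@fpsC K)) -rmorphM -[RHS](rmorph1 (@fpsC K)).
  by congr fpsC; field.
rewrite rmorphN /= -[RHS]q -[RHS]mulr1 -[in X in _ = _ * X](fps_expNK im); ring.
Qed.

Lemma fps_euler_sinc : fps_euler fps_sinc + fps_sinc = fps_cos.
Proof.
apply/funext => n; rewrite fpsDE /fps_cos fpsCM0 fpsDE /fps_euler.
rewrite /fps_sinc /fps_exp factS natrM [(- im) ^+ _]exprNn -natr1.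
have nf0 := fact_neq0 n.
have n10 : (1 + n%:R : K) != 0 by rewrite nat1r pnatr_eq0.
by field; rewrite nf0 n10.
Qed.

Lemma fps_sinc_even : fps_scale (-1) fps_sinc = fps_sinc.
Proof.
apply/funext => n; rewrite /fps_scale /fps_sinc.
by rewrite -signr_odd; case: (odd n); rewrite ?expr1 ?expr0; ring.
Qed.

(** w / sin w, whose powers carry the Laurent coefficients of the powers of
    the cosecant at 0. *)
Definition fps_wcsc : fps K := fps_sinc^-1.

Lemma fps_sincM_wcsc : fps_sinc * fps_wcsc = 1.
Proof. by rewrite divrr// fps_sinc_unit. Qed.

Lemma fps_wcsc0 : fps_wcsc 0%N = 1.
Proof. by rewrite /fps_wcsc fps_inv0E fps_sinc0 ?invr1 ?oner_neq0. Qed.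

(** The reciprocal of an even series is even, because w |-> - w acts on series
    by a ring morphism. *)
Lemma fps_wcsc_odd0 k n : odd n -> (fps_wcsc ^+ k) n = 0.
Proof.
apply: fps_even_odd0 => //.
by rewrite rmorphXn /= rmorphV ?fps_sinc_unit//= fps_sinc_even.
Qed.

Lemma fps_euler_wcsc :
  fps_euler fps_wcsc = fps_wcsc - fps_cos * fps_wcsc ^+ 2.
Proof.
have SD := fps_sincM_wcsc; rewrite -fps_euler_sinc.
have := congr1 (@fps_euler K) SD; rewrite fps_eulerM fps_euler1.
move=> /(congr1 ( *%R fps_wcsc)); rewrite mulr0 mulrDr => h.
have -> : fps_euler fps_wcsc = fps_sinc * fps_wcsc * fps_euler fps_wcsc.
  by rewrite SD mul1r.
apply/eqP; rewrite -subr_eq0 -h.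
apply/eqP.
transitivity ((fps_sinc * fps_wcsc - 1) * fps_wcsc + fps_wcsc *
    (fps_euler fps_sinc * fps_wcsc + fps_sinc * fps_euler fps_wcsc)); first by ring.
by rewrite SD subrr mul0r add0r mulrDr.
Qed.

(** The residue at 0 of csc^k cot is zero, because k csc^k cot is the
    derivative of - csc^k. *)
Lemma residue_csc_cot k : (0 < k)%N -> (fps_cos * fps_wcsc ^+ k.+1) k = 0.
Proof.
case: k => // k _; set f := _ * _.
have := congr1 (@^~ k.+1) (fps_eulerX fps_wcsc k).
have -> : fps_wcsc ^+ k * fps_euler fps_wcsc *+ k.+1 =
          fpsC k.+1%:R * (fps_wcsc ^+ k.+1 - f).
  rewrite fps_euler_wcsc (rmorph_nat (@fpsC K)) /f !exprS; ring.
rewrite fpsCM0 fpsBE /fps_euler => /mulfI.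
rewrite pnatr_eq0 => /(_ isT) /eqP.
by rewrite -[X in X == _]subr0 (inj_eq (addrI _)) eqr_opp eq_sym => /eqP.
Qed.

(** sin (x - w), with sx and cx standing for sin x and cos x *)
Definition fps_sinB sx cx : fps K :=
  fpsC sx * fps_cos - fpsC cx * fpsX * fps_sinc.

Lemma fps_sinB0 sx cx : fps_sinB sx cx 0%N = sx.
Proof.
by rewrite /fps_sinB fpsBE -mulrA !fpsCM0 fpsXM0 mulr0 subr0 fps_cos0 mulr1.
Qed.

Lemma fps_sinB_unit sx cx : sx != 0 -> fps_sinB sx cx \is a GRing.unit.
Proof. by rewrite fps_unitE fps_sinB0. Qed.

(** Algebraic form of
      csc (x - w) (csc^2 w - csc^2 x) = csc x csc w (cot w + cot x),
    multiplied by w^2 sin (x - w). *)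
Lemma fps_wcsc_sq sx cx : sx != 0 -> sx ^+ 2 + cx ^+ 2 = 1 ->
  fps_wcsc ^+ 2 = fpsC (sx^-1 ^+ 2) * fpsX ^+ 2
    + fpsC sx^-1 * fps_sinB sx cx *
      (fps_cos * fps_wcsc ^+ 2 + fpsC (cx / sx) * fpsX * fps_wcsc).
Proof.
move=> sx0 sc; have SD := fps_sincM_wcsc; have CS := fps_cosD_sinc2.
have -> : fpsC sx^-1 * fps_sinB sx cx =
          fps_cos - fpsC (cx / sx) * fpsX * fps_sinc.
  rewrite /fps_sinB mulrBr !mulrA.
  rewrite -(rmorphM (@fpsC K) sx^-1 sx) -(rmorphM (@fpsC K) sx^-1 cx) /=.
  rewrite mulVf// rmorph1 mul1r.
  by rewrite [sx^-1 * cx]mulrC.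
have -> : sx^-1 ^+ 2 = 1 + (cx / sx) ^+ 2.
  by rewrite -[LHS]mul1r -[X in X * _ = _]sc; field.
set k := cx / sx; rewrite rmorphD rmorph1 rmorphXn /=.
set D := fps_wcsc; set C := fps_cos in CS *; set S := fps_sinc in SD CS *.
set kk := fpsC k; rewrite -/D in SD.
rewrite -[LHS]mul1r -[X in X * _]CS.
have -> : (C ^+ 2 + fpsX ^+ 2 * S ^+ 2) * D ^+ 2 =
          C ^+ 2 * D ^+ 2 + fpsX ^+ 2 * (S * D) ^+ 2 by ring.
have -> : (C - kk * fpsX * S) * (C * D ^+ 2 + kk * fpsX * D) =
   C ^+ 2 * D ^+ 2 + kk * fpsX * C * D - kk * fpsX * C * D * (S * D)
   - kk ^+ 2 * fpsX ^+ 2 * (S * D) by ring.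
by rewrite SD; ring.
Qed.

(** The residue at w = 0 of csc^(2k+1) w csc (x - w) is csc^(2k+1) x.
    Passing from k to k + 1 multiplies it by csc^2 x, since the terms
    csc^(2k+2) cot and csc^(2k+2) left over by [fps_wcsc_sq] have zero residue:
    the former is a derivative, the latter is even. *)
Lemma csc_residue k sx cx : sx != 0 -> sx ^+ 2 + cx ^+ 2 = 1 ->
  (fps_wcsc ^+ k.*2.+1 * (fps_sinB sx cx)^-1) k.*2 = sx^-1 ^+ k.*2.+1.
Proof.
move=> sx0 sc; have VU := fps_sinB_unit cx sx0.
elim: k => [|k IH].
  by rewrite !expr1 fps_mul0E fps_wcsc0 mul1r fps_inv0E fps_sinB0.
set V := (fps_sinB sx cx)^-1 in IH *.
have {VU} SV : fps_sinB sx cx * V = 1 by rewrite divrr.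
have -> : fps_wcsc ^+ (k.+1).*2.+1 * V =
    fpsC (sx^-1 ^+ 2) * (fpsX * (fpsX * (fps_wcsc ^+ k.*2.+1 * V)))
    + fpsC sx^-1 * (fps_cos * fps_wcsc ^+ (k.+1).*2.+1
                    + fpsC (cx / sx) * (fpsX * fps_wcsc ^+ k.*2.+2)).
  rewrite doubleS; have -> : k.*2.+3 = (k.*2.+1 + 2)%N by rewrite addn2.
  rewrite !exprD {1}(fps_wcsc_sq sx0 sc) [fps_wcsc ^+ k.*2.+2]exprSr.
  set D := fps_wcsc; set Dk := D ^+ _; set c := fpsC (cx / sx).
  set s2 := fpsC (sx^-1 ^+ 2); set s := fpsC sx^-1; set S := fps_sinB _ _ in SV *.
  have -> : Dk * (s2 * fpsX ^+ 2 + s * S * (fps_cos * D ^+ 2 + c * fpsX * D)) * V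
    = Dk * s2 * fpsX ^+ 2 * V
      + Dk * s * (fps_cos * D ^+ 2 + c * fpsX * D) * (S * V) by ring.
  by rewrite SV; ring.
rewrite doubleS fpsDE !fpsCM0 !fpsXMS IH fpsDE fpsCM0 fpsXMS.
rewrite residue_csc_cot// fps_wcsc_odd0 /= ?odd_double//.
by rewrite mulr0 addr0 mulr0 addr0 -exprD.
Qed.

End FpsExp.

(** * Bernoulli numbers and w / sin w *)

Section WcscBernoulli.
Variables (K : numFieldType) (im : K).
Hypothesis im2 : im ^+ 2 = -1.

(** With b(x) = x / (e^x - 1), one has x / sinh x = 2 b(x) - b(2x); put
    x = i w. *)
Lemma fps_wcsc_expm1q : fps_wcsc im =
  2 * fps_scale im (fps_expm1q K)^-1 - fps_scale (2 * im) (fps_expm1q K)^-1.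
Proof.
have im0 := im_neq0 im2.
have two_im0 : 2 * im != 0 by rewrite mulf_neq0 ?pnatr_eq0.
rewrite !rmorphV ?fps_expm1q_unit//=.
have expm1q c : fpsC c * fpsX * fps_scale c (fps_expm1q K) = fps_exp c - 1.
  by rewrite -fps_scaleX -rmorphM /= fpsX_expm1q rmorphB /= fps_scale_exp mulr1
    rmorph1.
set E := fps_exp im; set S := fps_sinc im.
have EE : E * fps_exp (- im) = 1 by exact: fps_expNK.
have E2 : fps_exp (2 * im) = E ^+ 2 by rewrite fps_expMn mulrC.
have P1U : fps_scale im (fps_expm1q K) \is a GRing.unit.
  by rewrite rmorph_unit// fps_expm1q_unit.
have P2U : fps_scale (2 * im) (fps_expm1q K) \is a GRing.unit.
  by rewrite rmorph_unit// fps_expm1q_unit.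
set P1 := fps_scale im _ in P1U *; set P2 := fps_scale (2 * im) _ in P2U *.
have C2 : fpsC (2 * im) = 2 * fpsC im by rewrite rmorphM (rmorph_nat (@fpsC K)).
have P2E : 2 * P2 = P1 * (E + 1).
  apply: (fpsCX_inj im0) => /=.
  transitivity (fpsC (2 * im) * fpsX * P2); first by rewrite C2; ring.
  transitivity ((fpsC im * fpsX * P1) * (E + 1)); last by ring.
  by rewrite /P1 /P2 !expm1q E2 -/E; ring.
have P2S : P2 = E * S.
  apply: (fpsCX_inj two_im0) => /=.
  transitivity (E * (fpsC (2 * im) * fpsX * S)); last by ring.
  by rewrite /P2 expm1q E2 /S fpsX_sinc// mulrBr EE expr2.
have P1V := divrr P1U; have P2V := divrr P2U.
move: P1^-1 P2^-1 P1V P2V => Q1 Q2 P1V P2V.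
have Q1E : 2 * Q1 = (E + 1) * Q2.
  transitivity (2 * Q1 * (P2 * Q2)); first by rewrite P2V mulr1.
  transitivity (2 * P2 * (Q1 * Q2)); first by ring.
  rewrite P2E; transitivity (P1 * Q1 * ((E + 1) * Q2)); first by ring.
  by rewrite P1V mul1r.
apply: (mulrI (fps_sinc_unit im)); rewrite fps_sincM_wcsc -/S Q1E.
transitivity (E * S * Q2); last by ring.
by rewrite -P2S P2V.
Qed.

Lemma fps_wcscE n :
  fps_wcsc im n = im ^+ n * (2 - 2 ^+ n) * (fps_expm1q K)^-1 n.
Proof.
rewrite fps_wcsc_expm1q fpsBE -[2 in X in X - _](rmorph_nat (@fpsC K)) fpsCM0.
by rewrite /fps_scale exprMn; ring.
Qed.

End WcscBernoulli.

(** * The sum of the shifted cosecants *)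

Lemma prim_root_sum (K : fieldType) (z : K) d e : d.-primitive_root z ->
  \sum_(j < d) z ^+ (j * e) = if (d %| e)%N then d%:R else 0.
Proof.
move=> zP; under eq_bigr do rewrite mulnC exprM.
have := prim_order_dvd zP e; case: ifP => [_ /esym/eqP ze|_ /esym/negbT ze].
  under eq_bigr do rewrite ze expr1n.
  by rewrite sumr_const card_ord.
apply: (mulfI (_ : z ^+ e - 1 != 0)); first by rewrite subr_eq0.
by rewrite -subrX1 -exprM mulnC exprM (prim_expr_order zP) expr1n subrr mulr0.
Qed.

Lemma prim_root_sqr_neq0 (K : fieldType) (om : K) d :
  d.-primitive_root (om ^+ 2) -> om != 0.
Proof.
move=> zP; apply/eqP => om0; have := prim_expr_order zP.
rewrite om0 !expr0n gtn_eqF ?(prim_order_gt0 zP)// => /esym/eqP.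
by rewrite oner_eq0.
Qed.

(** Rotating u by powers of a 2d-th root of unity never reaches 1 or -1,
    because it does not change u^(2d). *)
Lemma rotation_sqr_neq1 (K : fieldType) (om u : K) d j :
  d.-primitive_root (om ^+ 2) -> u ^+ (2 * d) != 1 ->
  (om ^+ j * u) ^+ 2 != 1.
Proof.
move=> zP; apply: contraNneq => v2.
have -> : u ^+ (2 * d) = ((om ^+ j * u) ^+ 2) ^+ d; last by rewrite v2 expr1n.
have zdj : om ^+ (j * (2 * d)) = 1.
  have -> : (j * (2 * d) = 2 * d * j)%N by lia.
  by rewrite !exprM (prim_expr_order zP) expr1n.
by rewrite -exprM [RHS]exprMn -exprM zdj mul1r.
Qed.

Lemma subV_neq0 (K : fieldType) (v : K) : v != 0 -> v ^+ 2 != 1 ->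
  v - v^-1 != 0.
Proof.
move=> v0; apply: contraNneq => /eqP; rewrite subr_eq0 => /eqP vV.
by rewrite expr2 {2}vV mulfV.
Qed.

(** Partial fractions: expand 1 / (z^j Z - 1) as a geometric sum with
    denominator Z^d - 1, and keep the powers that survive summation over j. *)
Lemma partial_fractions (K : fieldType) (z : K) (Z : fps K) d k :
  d.-primitive_root z -> (k < d)%N -> Z ^+ d - 1 \is a GRing.unit ->
  \sum_(j < d) fpsC (z ^+ (j * (d - k))) / (fpsC (z ^+ j) * Z - 1) =
  d%:R * Z ^+ k / (Z ^+ d - 1).
Proof.
move=> zP kd ZU.
have geom j : (Z ^+ d - 1) =
    (fpsC (z ^+ j) * Z - 1) * \sum_(l < d) (fpsC (z ^+ j) * Z) ^+ l.
  rewrite -subrX1 exprMn -rmorphXn -exprM mulnC exprM (prim_expr_order zP).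
  by rewrite expr1n rmorph1 mul1r.
have jU j : fpsC (z ^+ j) * Z - 1 \is a GRing.unit.
  by move: ZU; rewrite (geom j) unitrM => /andP[].
transitivity (\sum_(j < d) \sum_(l < d)
    (fpsC (z ^+ (j * (d - k + l))) * (Z ^+ l / (Z ^+ d - 1)))).
  apply: eq_bigr => j _.
  have -> : (fpsC (z ^+ j) * Z - 1)^-1 =
      (\sum_(l < d) (fpsC (z ^+ j) * Z) ^+ l) / (Z ^+ d - 1).
    by apply: (mulrI (jU j)); rewrite divrr// mulrA -geom divrr.
  rewrite mulr_suml mulr_sumr; apply: eq_bigr => l _.
  by rewrite exprMn -rmorphXn -exprM !mulrA -rmorphM -exprD -mulnDr.
rewrite exchange_big /= (bigD1 (Ordinal kd)) //= [X in _ + X]big1 ?addr0.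
  rewrite subnK ?(ltnW kd)// -mulr_suml -rmorph_sum /= prim_root_sum// dvdnn.
  by rewrite rmorph_nat mulrA.
move=> l lk; rewrite -mulr_suml -rmorph_sum /= prim_root_sum//.
case: ifP => [/dvdnP[q qE]|_]; last by rewrite rmorph0 mul0r.
have ld := ltn_ord l; move: lk; rewrite -val_eqE /= => /eqP lk.
by case: q qE => [|[|q]] qE; nia.
Qed.

Section CscSum.
Variables (K : numFieldType) (im : K).
Hypothesis im2 : im ^+ 2 = -1.

(** Euler's formula for sin (x - w), with v = e^(ix) *)
Lemma fps_sinB_exp (v : K) : v != 0 ->
  fpsC (2 * im) * fps_sinB im ((v - v^-1) / (2 * im)) ((v + v^-1) / 2) =
  fpsC v * fps_exp (- im) - fpsC v^-1 * fps_exp im.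
Proof.
move=> v0; have im0 := im_neq0 im2.
have C2 : fpsC (2 : K) = 2 by exact: (rmorph_nat (@fpsC K)).
rewrite /fps_sinB mulrBr.
have -> : fpsC (2 * im) * (fpsC ((v + v^-1) / 2) * fpsX * fps_sinc im) =
    fpsC ((v + v^-1) / 2) * (fps_exp im - fps_exp (- im)).
  by rewrite -fpsX_sinc//; ring.
rewrite mulrA -rmorphM (_ : 2 * im * _ = v - v^-1); last first.
  by field; rewrite im0 v0.
rewrite /fps_cos !(rmorphM, rmorphD, rmorphN) /=.
have := congr1 (@fpsC K) (mulfV (_ : 2 != 0 :> K)).
rewrite rmorphM rmorph1 /= C2 pnatr_eq0 => /(_ isT).
set i2 := fpsC 2^-1; move=> i2E.
set E := fps_exp im; set E' := fps_exp (- im).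
transitivity (2 * i2 * (fpsC v * E' - fpsC v^-1 * E)); first by ring.
by rewrite i2E mul1r.
Qed.

(** The generating identity
      sum_j cos(pi m j / d) csc(pi j / d + y)
        = i d (q^m / (q^(2d) - 1) - q^(-m) / (q^(-2d) - 1)),  q = e^(iy),
    at y = pi b - w, with om = e^(i pi / d) and u = e^(i pi b).  For m = 2h + 1
    the two exponentials in the cosine turn the sum into two instances of
    [partial_fractions], with k = d - h - 1 and k = h. *)
Lemma csc_sum_series (d m : nat) (om u : K) :
  d.-primitive_root (om ^+ 2) -> odd m -> (m < d)%N -> u != 0 ->
  u ^+ (2 * d) != 1 ->
  \sum_(j < d) fpsC ((om ^+ (m * j) + (om ^+ (m * j))^-1) / 2) *
     (fps_sinB im ((om ^+ j * u - (om ^+ j * u)^-1) / (2 * im))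
                  ((om ^+ j * u + (om ^+ j * u)^-1) / 2))^-1 =
  fpsC (im * d%:R) *
    (fpsC (u ^+ m) * fps_exp (- (im * m%:R))
       / (fpsC (u ^+ (2 * d)) * fps_exp (- (2 * im * d%:R)) - 1)
     - fpsC (u ^- m) * fps_exp (im * m%:R)
       / (fpsC (u ^- (2 * d)) * fps_exp (2 * im * d%:R) - 1)).
Proof.
move=> zP m_odd md u0 u2d.
set z := om ^+ 2 in zP.
have d_gt0 : (0 < d)%N by exact: leq_ltn_trans md.
have im0 := im_neq0 im2.
have two_im0 : 2 * im != 0 by rewrite mulf_neq0 ?pnatr_eq0.
have om0 : om != 0 by exact: prim_root_sqr_neq0 zP.
have omj0 j : om ^+ j != 0 by rewrite expf_neq0.
pose h := m./2; have mE : m = h.*2.+1 by rewrite /h odd_halfK ?prednK ?odd_gt0.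
have hd : (h < d)%N by lia.
pose q := fpsC u * fps_exp (- im); pose q' := fpsC u^-1 * fps_exp im.
have qq' : q * q' = 1.
  rewrite /q /q' mulrACA -rmorphM mulfV// rmorph1 mul1r mulrC; exact: fps_expNK.
have qX k : q ^+ k = fpsC (u ^+ k) * fps_exp (- (im * k%:R)).
  by rewrite /q exprMn fps_expMn -rmorphXn mulNr.
have q'X k : q' ^+ k = fpsC (u ^- k) * fps_exp (im * k%:R).
  by rewrite /q' exprMn fps_expMn -rmorphXn /= exprVn.
have -> : 2 * im * d%:R = im * (2 * d)%:R by rewrite natrM; ring.
rewrite -!qX -!q'X.
have WE : q ^+ (2 * d) = (q ^+ 2) ^+ d by rewrite exprM.
have WU : (q ^+ 2) ^+ d - 1 \is a GRing.unit.
  rewrite -WE fps_unitE fpsBE fps1E fps_exp0E /q fpsCM0 /fps_exp divr1 mulr1.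
  by rewrite subr_eq0.
have cscE j : (fps_sinB im ((om ^+ j * u - (om ^+ j * u)^-1) / (2 * im))
                  ((om ^+ j * u + (om ^+ j * u)^-1) / 2))^-1 =
    fpsC (2 * im) * (fpsC (om ^+ j) * q) / (fpsC (z ^+ j) * q ^+ 2 - 1).
  set v := om ^+ j * u; have v0 : v != 0 by rewrite mulf_neq0.
  pose r := fpsC v * fps_exp (- im); pose r' := fpsC v^-1 * fps_exp im.
  have rE : fpsC (om ^+ j) * q = r by rewrite /q mulrA -rmorphM.
  have r2E : fpsC (z ^+ j) * q ^+ 2 = r ^+ 2.
    by rewrite -rE [RHS]exprMn -rmorphXn /= /z -!exprM mulnC.
  have rr' : r' * r = 1.
    rewrite /r /r' mulrACA -rmorphM mulVf// rmorph1 mul1r; exact: fps_expNK.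
  have r2U : r ^+ 2 - 1 \is a GRing.unit.
    rewrite fps_unitE fpsBE fps1E fps_exp0E /r fpsCM0 /fps_exp divr1 mulr1.
    by rewrite subr_eq0; exact: rotation_sqr_neq1 zP u2d.
  have sE : fpsC (2 * im) * fps_sinB im ((v - v^-1) / (2 * im)) ((v + v^-1) / 2)
      = r - r' by exact: fps_sinB_exp.
  rewrite rE r2E; set s := fps_sinB _ _ _ in sE *.
  have sU : s \is a GRing.unit.
    apply: fps_sinB_unit; rewrite mulf_neq0 ?invr_eq0// subV_neq0//.
    exact: rotation_sqr_neq1 zP u2d.
  apply: (mulrI sU); rewrite divrr// mulrA mulrA [s * _]mulrC sE.
  by rewrite mulrBl rr' -expr2 divrr.
under eq_bigr do rewrite cscE.
transitivity (fpsC im * q *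
  ((\sum_(j < d) fpsC (z ^+ (j * (d - (d - h.+1)))) / (fpsC (z ^+ j) * q ^+ 2 - 1))
  + \sum_(j < d) fpsC (z ^+ (j * (d - h))) / (fpsC (z ^+ j) * q ^+ 2 - 1))).
  rewrite -big_split mulr_sumr; apply: eq_bigr => j _ /=.
  rewrite -mulrDl -rmorphD !mulrA; congr (_ * _).
  rewrite [RHS]mulrAC -!rmorphM; congr (fpsC _ * _).
  have -> : z ^+ (j * (d - (d - h.+1))) = om ^+ j * om ^+ (m * j).
    by rewrite subKn// /z -exprM -exprD; congr (om ^+ _); lia.
  have -> : z ^+ (j * (d - h)) = om ^+ j / om ^+ (m * j).
    apply: (mulIf (omj0 (m * j)%N)); rewrite divfK//.
    rewrite /z -!exprM -exprD.
    have -> : (2 * (j * (d - h)) + m * j = 2 * (d * j) + j)%N by nia.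
    by rewrite exprD exprM exprM (prim_expr_order zP) expr1n mul1r.
  by field; rewrite omj0.
rewrite !partial_fractions//; last by rewrite ltn_subrL.
have q'q k : q' ^+ k * q ^+ k = 1 by rewrite -exprMn mulrC qq' expr1n.
(* The fraction in q^-1 is the one in q, up to clearing q^(2d). *)
have W'E : (q' ^+ (2 * d) - 1) * - q ^+ (2 * d) = (q ^+ 2) ^+ d - 1.
  by rewrite mulrN mulrBl q'q mul1r opprB WE.
have W'U : q' ^+ (2 * d) - 1 \is a GRing.unit.
  by move: WU; rewrite -W'E unitrM => /andP[].
have -> : q' ^+ m / (q' ^+ (2 * d) - 1) =
    - (q * (q ^+ 2) ^+ (d - h.+1)) / ((q ^+ 2) ^+ d - 1).
  apply: (mulIr W'U); apply: (mulIr WU); rewrite divrK// mulrAC divrK// -W'E.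
  have -> : q ^+ (2 * d) = q ^+ m * (q * (q ^+ 2) ^+ (d - h.+1)).
    by rewrite -exprM -exprS -exprD; congr (q ^+ _); lia.
  move: (q'q m) => q'm; set w := q * _.
  transitivity (q' ^+ m * q ^+ m * (- w * (q' ^+ (2 * d) - 1))); first by ring.
  by rewrite q'm mul1r.
rewrite WE.
have -> : q ^+ m = q * (q ^+ 2) ^+ h by rewrite mE -exprM -exprS mul2n.
rewrite rmorphM (rmorph_nat (@fpsC K)).
by move: (_^-1) => W; ring.
Qed.

End CscSum.

(** * Coefficients of products *)

Section Coefficients.
Variable K : fieldType.

Definition fps_agree L (f : fps K) (p : {poly K}) :=
  forall n, (n < L)%N -> f n = p`_n.

Lemma fps_agree1 L : fps_agree L 1 1.
Proof. by move=> n _; rewrite fps1E coef1. Qed.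

Lemma fps_agreeM L f g p q :
  fps_agree L f p -> fps_agree L g q -> fps_agree L (f * g) (p * q).
Proof.
move=> fp gq n nL; rewrite fpsME coefM; apply: eq_bigr => i _.
by rewrite fp ?gq// (leq_ltn_trans _ nL)// ?leq_subr// -ltnS.
Qed.

Lemma fps_agreeX L f p k : fps_agree L f p -> fps_agree L (f ^+ k) (p ^+ k).
Proof.
move=> fp; elim: k => [|k IH]; first by rewrite !expr0; exact: fps_agree1.
by rewrite !exprS; exact: fps_agreeM.
Qed.

(** The coefficient at M < L only sees the truncations at L, and a product of
    polynomials can be expanded as a finite sum. *)
Lemma coef_fps_even_powM (g : nat -> K) (f h1 h2 : fps K) N L M :
  (M < L)%N ->
  (forall n, f n = if odd n then 0 else g n./2) ->
  (f ^+ N * h1 * h2) M =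
  \sum_(j : {ffun 'I_N -> 'I_L}) \sum_(mu < L)
    \sum_(nu < L | (2 * (\sum_r j r) + mu + nu == M)%N)
      (\prod_r g (j r)) * h1 mu * h2 nu.
Proof.
move=> ML fE.
have f_agree : fps_agree L f (\sum_(k < L) g k *: 'X^(2 * k)).
  move=> n nL; rewrite fE coef_sum.
  under eq_bigr do rewrite coefZ coefXn.
  case: ifP => [n_odd|/negbT n_even].
    rewrite big1// => i _; rewrite (_ : (n == _) = false) ?mulr0//.
    by apply/eqP => nE; move: n_odd; rewrite nE oddM.
  have n2L : (n./2 < L)%N by lia.
  rewrite (bigD1 (Ordinal n2L)) //= big1 ?addr0.
    by rewrite mul2n even_halfK// eqxx mulr1.
  move=> i; rewrite -val_eqE /= => iN.
  by rewrite (_ : (n == _) = false) ?mulr0//; apply/eqP => nE; lia.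
have agree_poly (h : fps K) : fps_agree L h (\sum_(k < L) h k *: 'X^k).
  move=> n nL; rewrite coef_sum (bigD1 (Ordinal nL)) //= big1 ?addr0.
    by rewrite coefZ coefXn eqxx mulr1.
  move=> i; rewrite -val_eqE /= => iN.
  by rewrite coefZ coefXn eq_sym (negbTE iN) mulr0.
have := fps_agreeM (fps_agreeM (fps_agreeX N f_agree) (agree_poly h1))
  (agree_poly h2).
move=> /(_ M ML) ->.
have -> : (\sum_(k < L) g k *: 'X^(2 * k)) ^+ N =
    \sum_(j : {ffun 'I_N -> 'I_L})
      (\prod_r g (j r)) *: 'X^(\sum_r 2 * j r) :> {poly K}.
  rewrite -[N in LHS]card_ord -prodr_const bigA_distr_bigA /=.
  by apply: eq_bigr => j _; rewrite scaler_prod -expr_sum.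
rewrite 2!big_distrl /= coef_sum.
apply: eq_bigr => j _.
rewrite [X in X * _]mulr_sumr big_distrl coef_sum /=.
apply: eq_bigr => mu _; rewrite mulr_sumr coef_sum [RHS]big_mkcond.
apply: eq_bigr => nu _.
rewrite -!(scalerAl, scalerAr) -!exprD !coefZ coefXn -big_distrr /= eq_sym.
by case: ifP => _; rewrite ?mulr0 ?mulr1// mulrC.
Qed.

End Coefficients.

Section CscPowerSum.
Variables (K : numFieldType) (im : K).
Hypothesis im2 : im ^+ 2 = -1.

(** The theorem with exponentials replaced by arbitrary om and u: take the
    coefficient of w^(N-1) in (w / sin w)^N times [csc_sum_series]. *)
Lemma csc_power_sum (N d m : nat) (om u : K) (g a a' : nat -> K) :
  odd N -> d.-primitive_root (om ^+ 2) -> odd m -> (m < d)%N -> u != 0 ->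
  u ^+ (2 * d) != 1 ->
  (forall k, g k = - fps_wcsc im (2 * k)%N) ->
  (forall nu, a nu = nu`!%:R * (fpsC (u ^- (2 * d)) * fps_exp 1 - 1)^-1 nu) ->
  (forall nu, a' nu = nu`!%:R * (fpsC (u ^+ (2 * d)) * fps_exp 1 - 1)^-1 nu) ->
  \sum_(j < d) (om ^+ (m * j) + (om ^+ (m * j))^-1) / 2 *
    (2 * im / (om ^+ j * u - (om ^+ j * u)^-1)) ^+ N =
  - \sum_(j : {ffun 'I_N -> 'I_N}) \sum_(mu < N)
    \sum_(nu < N | (2 * (\sum_r j r) + mu + nu == N.-1)%N)
      im ^+ (mu + nu + 1) * 2 ^+ nu * (m%:R ^+ mu / mu`!%:R)
      * (d%:R ^+ (nu + 1) / nu`!%:R)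
      * (- u ^- m * a nu - (-1) ^+ (mu + nu) * - u ^+ m * a' nu)
      * \prod_r g (j r).
Proof.
move=> N_odd zP m_odd md u0 u2d gE aE a'E.
have im0 := im_neq0 im2.
have om0 : om != 0 by exact: prim_root_sqr_neq0 zP.
set k := N./2; have NE : N = k.*2.+1 by rewrite /k; lia.
transitivity ((fps_wcsc im ^+ N *
  \sum_(j < d) fpsC ((om ^+ (m * j) + (om ^+ (m * j))^-1) / 2) *
     (fps_sinB im ((om ^+ j * u - (om ^+ j * u)^-1) / (2 * im))
                  ((om ^+ j * u + (om ^+ j * u)^-1) / 2))^-1) N.-1).
  rewrite mulr_sumr fps_sumE; apply: eq_bigr => j _.
  rewrite mulrCA fpsCM0; congr (_ * _).
  set v := om ^+ j * u; have v0 : v != 0 by rewrite mulf_neq0 ?expf_neq0.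
  rewrite {1}NE [in RHS]NE /= csc_residue//.
  - by rewrite invf_div.
  - rewrite mulf_neq0 ?invr_eq0 ?mulf_neq0 ?pnatr_eq0// subV_neq0//.
    exact: rotation_sqr_neq1 zP u2d.
  - by rewrite !expr_div_n exprMn im2; field; rewrite v0.
rewrite csc_sum_series//.
pose Gs : fps K := fun n => if odd n then 0 else g n./2.
have -> : fps_wcsc im = - Gs.
  apply/funext => n; rewrite fpsNE /Gs; case: ifP => [n_odd|/negbT n_even].
    by rewrite -[fps_wcsc im]expr1 fps_wcsc_odd0// oppr0.
  by rewrite gE opprK mul2n even_halfK.
have scaleE (c t : K) : t != 1 -> (fpsC t * fps_exp c - 1)^-1 =
    fps_scale c (fpsC t * fps_exp 1 - 1)^-1.
  move=> t1; rewrite rmorphV /=; last first.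
    by rewrite fps_unitE fpsBE fps1E fpsCM0 /fps_exp divr1 mulr1 subr_eq0.
  by rewrite rmorphB rmorphM rmorph1 /= fps_scaleC fps_scale_exp mulr1.
(* Both reciprocals are 1 / (t e^w - 1) taken at a multiple of w. *)
rewrite (scaleE (- (2 * im * d%:R)) _ u2d) (scaleE (2 * im * d%:R)); last first.
  by rewrite invr_eq1.
have {}aE nu : (fpsC (u ^- (2 * d)) * fps_exp 1 - 1)^-1 nu = a nu / nu`!%:R.
  by rewrite aE [RHS]mulrC mulKf// fact_neq0.
have {}a'E nu : (fpsC (u ^+ (2 * d)) * fps_exp 1 - 1)^-1 nu = a' nu / nu`!%:R.
  by rewrite a'E [RHS]mulrC mulKf// fact_neq0.
move: (fpsC (u ^- (2 * d)) * fps_exp 1 - 1)^-1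
  (fpsC (u ^+ (2 * d)) * fps_exp 1 - 1)^-1 aE a'E => Q Q' QE Q'E.
set E1 := fps_exp (- (im * m%:R)); set E2 := fps_exp (im * m%:R).
set S1 := fps_scale _ Q'; set S2 := fps_scale _ Q.
have -> : (- Gs) ^+ N * (fpsC (im * d%:R) *
     (fpsC (u ^+ m) * E1 * S1 - fpsC (u ^- m) * E2 * S2)) =
   - (fpsC (im * d%:R * u ^+ m) * (Gs ^+ N * E1 * S1)
      - fpsC (im * d%:R * u ^- m) * (Gs ^+ N * E2 * S2)).
  rewrite exprNn -signr_odd N_odd expr1 !(rmorphM (@fpsC K) (im * _)) /=.
  move: (fpsC (im * _)) (fpsC (u ^+ m)) (fpsC (u ^- m)) (Gs ^+ N) => c1 c2 c3 GN.
  by ring.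
have NL : (N.-1 < N)%N by rewrite NE.
rewrite fpsNE fpsBE !fpsCM0; congr (- _).
rewrite !(coef_fps_even_powM (g := g) (f := Gs) _ _ N NL)// !mulr_sumr -sumrB.
apply: eq_bigr => j _; rewrite !mulr_sumr -sumrB.
apply: eq_bigr => mu _; rewrite !mulr_sumr -sumrB.
apply: eq_bigr => nu _; rewrite /S1 /S2 /E1 /E2 /fps_scale /fps_exp QE Q'E.
rewrite [(- (im * _)) ^+ _]exprNn [(- (2 * im * _)) ^+ _]exprNn.
rewrite !exprMn !exprD !expr1.
move: (\prod_r g (j r)) (fact_neq0 K mu) (fact_neq0 K nu) => P mu0 nu0.
by field; rewrite ?mu0 ?nu0 ?expf_neq0.
Qed.

End CscPowerSum.

(** * Power series expansions *)

Section PowerSeries.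
Local Open Scope classical_set_scope.
Variable K : numFieldType.
Implicit Types (a b : fps K) (z l : K) (u v : nat -> K).

Definition tendsto u l := u @ \oo --> l.

Lemma tendstoP u l : tendsto u l <->
  forall e, 0 < e -> exists N, forall n, (N <= n)%N -> `|u n - l| < e.
Proof.
split=> [/cvgrPdist_lt ul e e0|ul].
  have [N _ HN] := ul e e0.
  by exists N => n Nn; rewrite distrC; exact: HN.
apply/cvgrPdist_lt => e e0; have [N HN] := ul e e0.
by exists N => // n Nn; rewrite distrC; exact: HN.
Qed.

Lemma tendsto_cst l : tendsto (fun=> l) l.
Proof. exact: cvg_cst. Qed.

Lemma tendstoD u v l1 l2 : tendsto u l1 -> tendsto v l2 ->
  tendsto (fun n => u n + v n) (l1 + l2).
Proof. exact: cvgD. Qed.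

Lemma tendstoB u v l1 l2 : tendsto u l1 -> tendsto v l2 ->
  tendsto (fun n => u n - v n) (l1 - l2).
Proof. exact: cvgB. Qed.

Lemma tendstoM u v l1 l2 : tendsto u l1 -> tendsto v l2 ->
  tendsto (fun n => u n * v n) (l1 * l2).
Proof. exact: cvgM. Qed.

Definition psum a z n : K := \sum_(k < n) a k * z ^+ k.

Definition expansion (f : K -> K) a :=
  exists2 e : K, 0 < e & forall z, `|z| < e -> tendsto (psum a z) (f z).

Lemma egf_expansionP (f : K -> K) (c : nat -> K) :
  egf_expansion f c <-> expansion f (fun k => c k / k`!%:R).
Proof.
have E z : series (fun k : nat => c k / (k`!)%:R * z ^+ k) =
    psum (fun k => c k / k`!%:R) z.
  by apply/funext => n; rewrite /series /psum /= big_mkord.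
split=> [/nbhs_norm0P[e /= e0 H]|[e e0 H]].
  by exists e => // z ze; rewrite -E; exact: H.
by apply/nbhs_norm0P; exists e => // z ze; rewrite E; exact: H.
Qed.

Lemma half_sum_le2 (t : K) n : 0 <= t -> t <= 2^-1 -> \sum_(k < n) t ^+ k <= 2.
Proof.
move=> t0 t2; elim: n => [|n IH]; first by rewrite big_ord0.
rewrite big_ord_recl; under eq_bigr do rewrite exprS.
rewrite -mulr_sumr -[2]/(1 + 1) lerD2l.
by rewrite -[leRHS](mulVf (_ : 2 != 0 :> K)) ?pnatr_eq0// ler_pM ?sumr_ge0// => *;
  rewrite exprn_ge0.
Qed.

Lemma psum0_bounded a z : tendsto (psum a z) 0 ->
  exists2 C, 0 < C & forall k, `|a k * z ^+ k| <= C.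
Proof.
move=> /tendstoP /(_ 1 ltr01)[N HN].
exists (2 + \sum_(j < N) `|a j * z ^+ j|).
  by rewrite ltr_wpDr ?sumr_ge0.
move=> k; case: (ltnP k N) => kN.
  rewrite (bigD1 (Ordinal kN)) //= addrCA lerDl addr_ge0// sumr_ge0//.
rewrite ler_wpDr ?sumr_ge0//.
have -> : a k * z ^+ k = psum a z k.+1 - psum a z k.
  by rewrite /psum big_ord_recr /= addrAC subrr add0r.
rewrite (le_trans (ler_normB _ _))// lerD//.
  by have := HN k.+1 (leqW kN); rewrite subr0 => /ltW.
by have := HN k kN; rewrite subr0 => /ltW.
Qed.

(** The first nonzero coefficient would dominate the rest of the series at a
    small enough point. *)
Lemma expansion0 a : expansion (fun=> 0) a -> forall k, a k = 0.
Proof.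
move=> [e e0 He].
have [r r0 re] : exists2 r, 0 < r & r < e.
  by exists (e / 2); rewrite ?divr_gt0// ltr_pdivrMr// ltr_pMr// ltr1n.
have [C C0 HC] : exists2 C, 0 < C & forall k, `|a k * r ^+ k| <= C.
  by apply: psum0_bounded; apply: He; rewrite ger0_norm// ltW.
move=> k; elim/ltn_ind: k => k IH.
apply/eqP; apply: contraT => ak0.
have [A AE] : exists A, A = `|a k| * r ^+ k by eexists.
have A0 : 0 < A by rewrite AE mulr_gt0 ?normr_gt0 ?exprn_gt0.
have AC : A <= C.
  by have := HC k; rewrite AE normrM (ger0_norm (exprn_ge0 _ (ltW r0))).
(* At x = r t the tail is at most t^k (A / 2), half of the k-th term. *)
have [t tE] : exists t, t = A / (4 * C) by eexists.
have t0 : 0 < t by rewrite tE divr_gt0// mulr_gt0.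
have tle : t <= 2^-1.
  rewrite tE ler_pdivrMr ?mulr_gt0// (le_trans AC)//.
  rewrite mulrA ler_peMl ?(ltW C0)//.
  by rewrite mulrC ler_pdivlMr// mul1r ler_nat.
have [x xE] : exists x, x = r * t by eexists.
have x0 : 0 <= x by rewrite xE mulr_ge0 ?ltW.
have xe : `|x| < e.
  rewrite (ger0_norm x0) xE.
  apply: le_lt_trans re; rewrite ler_piMr ?(ltW r0)// (le_trans tle)//.
  by rewrite invf_le1// ler1n.
have := He x xe; move/tendstoP => /(_ (t ^+ k * (A / 2)))[].
  by rewrite mulr_gt0 ?exprn_gt0 ?divr_gt0.
move=> N /(_ (k.+1 + N)%N) /(_ (leq_addl _ _)); rewrite subr0 => HN.
have : t ^+ k * (A / 2) <= `|psum a x (k.+1 + N)|.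
  rewrite /psum big_split_ord /= big_ord_recr /= big1 ?add0r; last first.
    by move=> i _; rewrite IH ?mul0r.
  rewrite -[X in _ <= `|_ + X|]opprK (le_trans _ (lerB_dist _ _))// normrN.
  rewrite lerBrDr.
  have -> : `|a k * x ^+ k| = t ^+ k * A.
    by rewrite normrM normrX (ger0_norm x0) xE AE exprMn; ring.
  have tail : `|\sum_(i < N) a (k.+1 + i)%N * x ^+ (k.+1 + i)| <=
      t ^+ k * (t * C) * 2.
    apply: (@le_trans _ _ (\sum_(i < N) t ^+ k * (t * C) * t ^+ i)).
      apply: (le_trans (ler_norm_sum _ _ _)); apply: ler_sum => i _.
      rewrite xE exprMn [X in `|X|]mulrA normrM.
      rewrite [`|t ^+ _|]ger0_norm ?exprn_ge0 ?(ltW t0)//.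
      have -> : t ^+ k * (t * C) * t ^+ i = C * t ^+ (k.+1 + i).
        by rewrite exprD exprS; ring.
      by rewrite ler_wpM2r ?exprn_ge0 ?(ltW t0).
    rewrite -mulr_sumr ler_wpM2l ?half_sum_le2 ?(ltW t0)//.
    by rewrite !mulr_ge0 ?exprn_ge0 ?(ltW t0) ?(ltW C0).
  apply: (le_trans (lerD (lexx _) tail)).
  rewrite le_eqVlt; apply/orP; left; apply/eqP.
  by rewrite tE; field; rewrite gt_eqF.
by move=> /le_lt_trans /(_ HN); rewrite ltxx.
Qed.

Lemma expansion_unique f a b : expansion f a -> expansion f b -> a = b.
Proof.
move=> [e1 e10 H1] [e2 e20 H2].
have H : expansion (fun=> 0) (a - b).
  exists ((e1^-1 + e2^-1)^-1); first by rewrite invr_gt0 addr_gt0 ?invr_gt0.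
  move=> z ze; have z1 : `|z| < e1.
    apply: (lt_trans ze); rewrite -[ltRHS]invrK ltf_pV2 ?posrE ?addr_gt0 ?invr_gt0//.
    by rewrite ltrDl invr_gt0.
  have z2 : `|z| < e2.
    apply: (lt_trans ze); rewrite -[ltRHS]invrK ltf_pV2 ?posrE ?addr_gt0 ?invr_gt0//.
    by rewrite ltrDr invr_gt0.
  have -> : psum (a - b) z = psum a z - psum b z.
    apply/funext => n; rewrite fctE /psum -sumrB.
    by apply: eq_bigr => i _; rewrite fpsBE mulrBl.
  by rewrite -(subrr (f z)); apply: cvgB; [exact: H1|exact: H2].
apply/funext => k; apply/eqP; rewrite -subr_eq0; apply/eqP.
exact: (expansion0 H k).
Qed.

Lemma egf_coefE f a : expansion f a -> egf_coef f = (fun k => k`!%:R * a k).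
Proof.
have n0 k : (k`!%:R : K) != 0 by exact: fact_neq0.
move=> fa; apply: xget_unique.
  apply/egf_expansionP; suff -> : (fun k => k`!%:R * a k / k`!%:R) = a by [].
  by apply/funext => k; rewrite mulrC mulKf.
move=> c /egf_expansionP /(expansion_unique fa) ->.
by apply/funext => k; rewrite mulrC divfK.
Qed.

(** * Products and reciprocals of power series *)

(* 2^-n tends to 0; this lets one proof serve the real and the complex case. *)
Hypothesis arch : forall e : K, 0 < e -> exists n, 2^-1 ^+ n < e.

Lemma tendsto0_half u C : (forall n, `|u n| <= C * 2^-1 ^+ n) -> tendsto u 0.
Proof.
move=> uC; apply/tendstoP => e e0.
have C0 : 0 <= C by have := le_trans (normr_ge0 _) (uC 0%N); rewrite expr0 mulr1.
have C1 : 0 < C + 1 by rewrite ltr_wpDl.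
have [N HN] := arch (divr_gt0 e0 C1).
exists N => n Nn; rewrite subr0 (le_lt_trans (uC n))//.
apply: (@le_lt_trans _ _ ((C + 1) * 2^-1 ^+ N)); last first.
  by rewrite mulrC -ltr_pdivlMr.
rewrite ler_pM ?exprn_ge0 ?invr_ge0 ?lerDl//.
by rewrite ler_wiXn2l// ?invr_ge0// invf_le1// ler1n.
Qed.

(** The difference consists of the products a_i b_j z^(i+j) with i, j < n <= i+j.
    Those with i + j = k number at most k + 1 <= 2^k, each of size at most
    Ca Cb 8^-k, so every k contributes at most Ca Cb 4^-n. *)
Lemma psumM_tail a b Ca Cb L z n : 0 <= L ->
  (forall k, `|a k| <= Ca * L ^+ k) -> (forall k, `|b k| <= Cb * L ^+ k) ->
  L * `|z| <= 8^-1 ->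
  `|psum a z n * psum b z n - psum (a * b) z n| <= Ca * Cb * 2^-1 ^+ n.
Proof.
move=> L0 Ha Hb Lz.
have Ca0 : 0 <= Ca by have := le_trans (normr_ge0 _) (Ha 0%N); rewrite expr0 mulr1.
have Cb0 : 0 <= Cb by have := le_trans (normr_ge0 _) (Hb 0%N); rewrite expr0 mulr1.
have Lz0 : 0 <= L * `|z| by rewrite mulr_ge0.
pose p := fps_trunc n a * fps_trunc n b.
have psumE c : psum c z n = (fps_trunc n c).[z].
  rewrite (@horner_coef_wide _ n) ?size_poly//; apply: eq_bigr => i _.
  by rewrite coef_fps_trunc.
have p_size : (size p <= n + n)%N.
  rewrite (leq_trans (size_polyMleq _ _))// (leq_trans (leq_pred _))// leq_add//;
  exact: size_poly.
have p_coef k : `|p`_k| <= k.+1%:R * (Ca * Cb * L ^+ k).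
  rewrite coefM (le_trans (ler_norm_sum _ _ _))//.
  rewrite mulr_natl -[X in _ *+ X]card_ord -sumr_const ler_sum// => i _.
  have tr c C j : (forall k, `|c k| <= C * L ^+ k) -> 0 <= C ->
      `|(fps_trunc n c)`_j| <= C * L ^+ j.
    move=> Hc C0; rewrite coef_poly; case: ifP => // _.
    by rewrite normr0 mulr_ge0 ?exprn_ge0.
  have -> : L ^+ k = L ^+ i * L ^+ (k - i) by rewrite -exprD subnKC// -ltnS.
  by rewrite normrM mulrACA ler_pM// tr.
have -> : psum a z n * psum b z n - psum (a * b) z n =
    \sum_(i < n) p`_(n + i) * z ^+ (n + i).
  rewrite !psumE -hornerM -/p (horner_coef_wide _ p_size) big_split_ord /=.
  have -> : (fps_trunc n (a * b)).[z] = \sum_(i < n) p`_i * z ^+ i.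
    rewrite -psumE; apply: eq_bigr => i _; congr (_ * _).
    by rewrite /p coef_fps_truncM.
  by rewrite addrAC subrr add0r.
apply: (@le_trans _ _ (\sum_(i < n) Ca * Cb * 4^-1 ^+ n)).
  apply: (le_trans (ler_norm_sum _ _ _)); apply: ler_sum => i _.
  rewrite normrM normrX.
  apply: (@le_trans _ _ ((n + i).+1%:R * (Ca * Cb * L ^+ (n + i)) * `|z| ^+ (n + i))).
    by rewrite ler_wpM2r// exprn_ge0.
  have -> : (n + i).+1%:R * (Ca * Cb * L ^+ (n + i)) * `|z| ^+ (n + i) =
      Ca * Cb * ((n + i).+1%:R * (L * `|z|) ^+ (n + i)) by rewrite exprMn; ring.
  rewrite ler_wpM2l ?mulr_ge0//.
  apply: (@le_trans _ _ (2 ^+ (n + i) * 8^-1 ^+ (n + i))).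
    rewrite ler_pM ?exprn_ge0//.
      by rewrite -natrX ler_nat ltn_expl.
    by rewrite lerXn2r ?nnegrE ?invr_ge0.
  rewrite -exprMn (_ : 2 / 8 = 4^-1); last by field.
  by rewrite ler_wiXn2l ?leq_addr// ?invr_ge0// invf_le1// ler1n.
rewrite sumr_const card_ord -[leLHS]mulr_natl mulrCA ler_wpM2l ?mulr_ge0//.
apply: (@le_trans _ _ (2 ^+ n * 4^-1 ^+ n)).
  by rewrite ler_wpM2r ?exprn_ge0 ?invr_ge0// -natrX ler_nat ltnW// ltn_expl.
by rewrite -exprMn (_ : 2 / 4 = 2^-1); last by field.
Qed.

(** The limit l is not 0, for u v would tend to 0 with v bounded. *)
Lemma tendsto_inv u v l M : tendsto u l -> tendsto (u * v) 1 ->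
  (forall n, `|v n| <= M) -> tendsto v l^-1.
Proof.
move=> ul uv vM.
have M0 : 0 <= M by rewrite (le_trans _ (vM 0%N)).
have M1 : 0 < M + 1 by rewrite ltr_wpDl.
have l0 : l != 0.
  apply/eqP => l0; move/tendstoP: ul => /(_ ((M + 1)^-1 / 2)) [].
    by rewrite divr_gt0 ?invr_gt0.
  move=> N1 H1; move/tendstoP: uv => /(_ 2^-1) [|N2 H2]; first by rewrite invr_gt0.
  have := H1 (N1 + N2)%N (leq_addr _ _); have := H2 (N1 + N2)%N (leq_addl _ _).
  set n := (N1 + N2)%N; rewrite l0 subr0 fctE => h2 h1.
  have h3 : `|u n * v n| <= 2^-1.
    have -> : 2^-1 = ((M + 1)^-1 / 2) * (M + 1) by field; rewrite gt_eqF.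
    by rewrite normrM ler_pM// ?(ltW h1)// (le_trans (vM n))// lerDl.
  have h4 : `|1 : K| <= `|1 - u n * v n| + `|u n * v n|.
    by rewrite -{1}(subrK (u n * v n) 1) ler_normD.
  rewrite normr1 distrC in h4; have := le_lt_trans h4 (ltr_leD h2 h3).
  have -> : 2^-1 + 2^-1 = 1 :> K by field.
  by rewrite ltxx.
have uuv : tendsto (fun n => (u n)^-1 * (u n * v n)) l^-1.
  by rewrite -[l^-1]mulr1; exact: cvgM (cvgV l0 ul) uv.
have /tendstoP ul' := ul; have [|N1 H1] := ul' `|l|; first by rewrite normr_gt0.
apply/tendstoP => e e0; have /tendstoP /(_ e e0)[N2 H2] := uuv.
exists (N1 + N2)%N => n Nn.
have := H2 n (leq_trans (leq_addl _ _) Nn); rewrite mulKf//.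
have := H1 n (leq_trans (leq_addr _ _) Nn).
by apply: contraTneq => ->; rewrite sub0r normrN ltxx.
Qed.

Lemma tendsto_psum1 z : tendsto (psum (1 : fps K) z) 1.
Proof.
apply/tendstoP => e e0; exists 1%N => -[//|n] _.
rewrite /psum big_ord_recl fps1E mul1r expr0 big1 ?addr0 ?subrr ?normr0//.
by move=> i _; rewrite fps1E mul0r.
Qed.

(** With A = |a_0|, the recurrence for the reciprocal multiplies a bound
    proportional to L^n by at most (C / A) (1 / L + 1 / L^2 + ...) at each step,
    and this factor is 1 for L = 1 + C / A. *)
Lemma fps_inv_bound a C : a 0%N != 0 -> (forall k, `|a k| <= C) ->
  forall n, `|a^-1 n| <= `|a 0%N|^-1 * (1 + C / `|a 0%N|) ^+ n.
Proof.
move=> a0 aC; have [A AE] : exists A, A = `|a 0%N| by eexists.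
have A0 : 0 < A by rewrite AE normr_gt0.
have C0 : 0 <= C by exact: le_trans (normr_ge0 _) (aC 0%N).
rewrite -AE; have [L LE] : exists L, L = 1 + C / A by eexists.
have L1 : 1 <= L by rewrite LE lerDl divr_ge0// ltW.
have L0 : 0 <= L by exact: le_trans L1.
rewrite -LE; elim/ltn_ind => -[_|n IH].
  by rewrite fps_inv0E// normfV -AE expr0 mulr1.
rewrite fps_invE fps_invS//.
rewrite normrN normrM normfV -AE ler_wpM2l ?invr_ge0 ?(ltW A0)//.
apply: (@le_trans _ _ (\sum_(i < n.+1) (L - 1) * L ^+ (n - i))).
  apply: (le_trans (ler_norm_sum _ _ _)); apply: ler_sum => i _.
  rewrite normrM.
  have -> : (L - 1) * L ^+ (n - i) = C * (A^-1 * L ^+ (n - i)) by rewrite LE; ring.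
  by rewrite ler_pM// -fps_invE IH// ltnS leq_subr.
rewrite -mulr_sumr (reindex_inj rev_ord_inj) /=.
under eq_bigr => i _ do rewrite subSS subKn -1?ltnS//.
by rewrite -subrX1 lerBlDr lerDl.
Qed.

(** The coefficients of the reciprocal grow at most geometrically, so the
    partial sums of the two series multiply to 1 in the limit. *)
Lemma expansion_inv f a C : a 0%N != 0 -> (forall k, `|a k| <= C) ->
  expansion f a -> expansion (fun z => (f z)^-1) a^-1.
Proof.
move=> a0 aC [e e0 fa].
have bB := fps_inv_bound a0 aC.
have C0 : 0 <= C by exact: le_trans (normr_ge0 _) (aC 0%N).
have A0 : 0 < `|a 0%N| by rewrite normr_gt0.
move: (`|a 0%N|) A0 bB => A A0 bB.
have [L LE] : exists L, L = 1 + C / A by eexists.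
have L1 : 1 <= L by rewrite LE lerDl divr_ge0// ltW.
have L0 : 0 < L by exact: lt_le_trans L1.
rewrite -LE in bB.
exists ((e^-1 + 8 * L)^-1).
  by rewrite invr_gt0 addr_gt0 ?invr_gt0 ?mulr_gt0.
move=> z ze.
have z1 : `|z| < e.
  apply: (lt_trans ze); rewrite -[ltRHS]invrK.
  rewrite ltf_pV2 ?posrE ?addr_gt0 ?invr_gt0 ?mulr_gt0//.
  by rewrite ltrDl mulr_gt0.
have z2 : L * `|z| <= 8^-1.
  rewrite mulrC -ler_pdivlMr//; apply: (le_trans (ltW ze)).
  rewrite -invfM lef_pV2 ?posrE ?addr_gt0 ?invr_gt0 ?mulr_gt0//.
  by rewrite lerDr invr_ge0 ltW.
apply: (@tendsto_inv (psum a z) _ _ (A^-1 * 2)); first exact: fa.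
  rewrite (_ : _ * _ = (psum a z * psum a^-1 z - psum 1 z) + psum 1 z); last first.
    by rewrite subrK.
  rewrite -[X in tendsto _ X]add0r; apply: cvgD; last exact: tendsto_psum1.
  apply: (@tendsto0_half _ (C * A^-1)) => n.
  rewrite -(divrr (_ : a \is a GRing.unit))//.
  apply: (psumM_tail (L := L)) => //; first exact: ltW.
  by move=> k; rewrite (le_trans (aC k))// ler_peMr// exprn_ege1.
move=> n; apply: (@le_trans _ _ (\sum_(k < n) A^-1 * (L * `|z|) ^+ k)).
  apply: (le_trans (ler_norm_sum _ _ _)); apply: ler_sum => i _.
  by rewrite normrM normrX exprMn mulrA ler_wpM2r ?exprn_ge0.
rewrite -mulr_sumr ler_wpM2l ?invr_ge0 ?(ltW A0)// half_sum_le2//.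
  by rewrite mulr_ge0 ?(ltW L0).
by rewrite (le_trans z2)// lef_pV2 ?posrE// ler_nat.
Qed.

End PowerSeries.

(** * Expansions of the functions in the statement *)

Lemma arch_real (R : realType) (e : R) : 0 < e -> exists n, 2^-1 ^+ n < e.
Proof.
move=> e0; exists (Num.bound e^-1).
rewrite exprVn -[ltRHS]invrK ltf_pV2 ?posrE ?exprn_gt0 ?invr_gt0//.
apply: (lt_trans (archi_boundP (ltW _))); first by rewrite invr_gt0.
by rewrite -natrX ltr_nat ltn_expl.
Qed.

Lemma gt0_complexE (R : realType) (e : R[i]) : 0 < e ->
  exists2 r : R, 0 < r & e = r%:C.
Proof.
case: e => r s; rewrite ltcE /= => /andP[/eqP s0 r0]; exists r => //.
by rewrite s0.
Qed.

Lemma arch_complex (R : realType) (e : R[i]) :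
  0 < e -> exists n, 2^-1 ^+ n < e.
Proof.
move=> /gt0_complexE[r r0 ->]; have [n rn] := arch_real r0; exists n.
have -> : 2^-1 ^+ n = (2^-1 ^+ n)%:C :> R[i].
  by rewrite rmorphXn /= fmorphV /= (rmorph_nat (real_complex R)).
by rewrite ltcR.
Qed.

Section ComplexExp.
Variable R : realType.
Implicit Types (x y : R) (z : R[i]).

Lemma norm_real_complex x : `|x%:C| = `|x|%:C.
Proof. by rewrite normc_def /= expr0n /= addr0 sqrtr_sqr. Qed.

Lemma norm_im : `|'i%C : R[i]| = 1.
Proof. by rewrite normc_def /= expr0n /= add0r expr1n sqrtr1. Qed.

Lemma tendsto_real_complex (u : nat -> R) (l : R) : tendsto u l ->
  tendsto (fun n => (u n)%:C) l%:C.
Proof.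
move=> /tendstoP ul; apply/tendstoP => e /gt0_complexE[r r0 ->].
have [N HN] := ul r r0; exists N => n Nn.
by rewrite -rmorphB /= norm_real_complex ltcR HN.
Qed.

Lemma psum_expE (K : numFieldType) (c : K) :
  psum (fps_exp c) 1 = psum (fps_exp 1) c.
Proof.
apply/funext => n; apply: eq_bigr => k _.
by rewrite /fps_exp !expr1n mulr1 mul1r mulrC.
Qed.

Lemma tendsto_expR x : tendsto (psum (fps_exp 1) x) (expR x).
Proof.
rewrite (_ : psum _ _ = series (exp_coeff x)).
  exact: is_cvg_series_exp_coeff.
apply/funext => n; rewrite /series /= big_mkord; apply: eq_bigr => k _.
by rewrite /fps_exp expr1n mul1r mulrC.
Qed.

Definition cis x : R[i] := cos x +i* sin x.

Lemma tendsto_cis y : tendsto (psum (fps_exp ('i%C * y%:C)) 1) (cis y).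
Proof.
have -> : cis y = (cos y)%:C + 'i%C * (sin y)%:C by rewrite [LHS]complexE.
have -> : psum (fps_exp ('i%C * y%:C)) 1 =
    (fun n => (series (cos_coeff y) n)%:C + 'i%C * (series (sin_coeff y) n)%:C).
  apply/funext => n; rewrite /series /= !big_mkord /psum.
  rewrite !rmorph_sum mulr_sumr -big_split /=; apply: eq_bigr => k _.
  rewrite /fps_exp expr1n mulr1 exprMn /cos_coeff /sin_coeff /=.
  have -> : ('i%C : R[i]) ^+ k =
      (~~ odd k)%:R * (-1) ^+ k./2 + 'i%C * ((odd k)%:R * (-1) ^+ k.-1./2).
    rewrite -{1}(odd_double_half k) exprD -muln2 mulnC exprM sqr_i.
    case: (boolP (odd k)) => ok /=; last by rewrite expr0 mul0r mulr0 addr0.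
    have -> : k.-1./2 = k./2 by lia.
    by rewrite mul0r add0r mul1r expr1.
  rewrite !(rmorphM, rmorphXn, rmorphN, rmorph1, rmorph_nat, fmorphV) /=.
  ring.
apply: tendstoD; last (apply: tendstoM; first exact: tendsto_cst).
  by apply: tendsto_real_complex; rewrite unlock; exact: is_cvg_series_cos_coeff.
by apply: tendsto_real_complex; rewrite unlock; exact: is_cvg_series_sin_coeff.
Qed.

Lemma cexpE z : cexp z = (expR (complex.Re z))%:C * cis (complex.Im z).
Proof. by case: z. Qed.

(** The product formula e^x e^(iy) = e^(x+iy) for partial sums, taken at 1
    with the exponents carried by the coefficients. *)
Lemma expansion_cexp : expansion (@cexp R) (fps_exp 1).
Proof.
exists (8^-1) => [|z ze]; first by rewrite invr_gt0.
rewrite -psum_expE cexpE.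
have Rez : `|(complex.Re z)%:C| <= 8^-1.
  by rewrite norm_real_complex (le_trans (normc_ge_Re z))// ltW.
have Imz : `|'i%C * (complex.Im z)%:C| <= 8^-1.
  rewrite normrM norm_im mul1r norm_real_complex.
  rewrite -normrN -ReiNIm (le_trans (normc_ge_Re _))//.
  by rewrite normrM norm_im mulr1 ltW.
have exp_bound (c : R[i]) k : `|c| <= 8^-1 -> `|fps_exp c k| <= 1 * 8^-1 ^+ k.
  move=> c8; rewrite mul1r /fps_exp normrM normrX normfV normr_nat.
  rewrite (@le_trans _ _ (`|c| ^+ k))//.
    by rewrite ler_piMr ?exprn_ge0// invf_le1 ?ltr0n ?fact_gt0// ler1n fact_gt0.
  by rewrite lerXn2r ?nnegrE ?invr_ge0.
have [x xE] : exists x : R[i], x = (complex.Re z)%:C by eexists.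
have [y yE] : exists y : R[i], y = 'i%C * (complex.Im z)%:C by eexists.
have xyE : fps_exp z = fps_exp x * fps_exp y.
  by rewrite -fps_expD [in LHS](complexE z) xE yE.
rewrite -xE in Rez; rewrite -yE in Imz.
have lim : tendsto (fun n => psum (fps_exp x) 1 n * psum (fps_exp y) 1 n)
    ((expR (complex.Re z))%:C * cis (complex.Im z)).
  apply: tendstoM; last by rewrite yE; exact: tendsto_cis.
  rewrite psum_expE xE.
  have -> : psum (fps_exp 1) (complex.Re z)%:C =
      (fun n => (psum (fps_exp 1) (complex.Re z) n)%:C).
    apply/funext => n; rewrite /psum rmorph_sum; apply: eq_bigr => k _.
    by rewrite rmorphM rmorphXn /fps_exp !expr1n !div1r fmorphV rmorph_nat.
  by apply: tendsto_real_complex; exact: tendsto_expR.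
have diff : tendsto (fun n => psum (fps_exp x) 1 n * psum (fps_exp y) 1 n
    - psum (fps_exp z) 1 n) 0.
  apply: (@tendsto0_half _ (@arch_complex R) _ (1 * 1)) => n; rewrite xyE.
  apply: (psumM_tail (L := 8^-1)) => //; rewrite ?normr1 ?mulr1//.
  - by move=> k; exact: exp_bound.
  - by move=> k; exact: exp_bound.
have := tendstoB lim diff; rewrite subr0.
by under [X in tendsto X _]eq_fun do rewrite subKr.
Qed.

(** For t <> 1 the series t e^z - 1 has a nonzero constant term, so its formal
    reciprocal is the convergent expansion that defines the A_nu(t). *)
Lemma A_fpsE (t : R[i]) nu : t != 1 ->
  A nu t = nu`!%:R * (fpsC t * fps_exp 1 - 1)^-1 nu.
Proof.
move=> t1.
rewrite /A (egf_coefE (a := (fpsC t * fps_exp 1 - 1)^-1))//.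
apply: (@expansion_inv _ (@arch_complex R) (fun z => t * cexp z - 1) _ (`|t| + 1)).
- by rewrite fpsBE fps1E fpsCM0 /fps_exp divr1 mulr1 subr_eq0.
- move=> k; rewrite fpsBE fps1E fpsCM0 (le_trans (ler_normB _ _))// lerD//.
    rewrite normrM ler_piMr// /fps_exp expr1n mul1r normfV normr_nat.
    by rewrite invf_le1 ?ltr0n ?fact_gt0// ler1n fact_gt0.
  by rewrite normr_nat lern1; case: k.
have [e e0 He] := expansion_cexp; exists e; first exact: e0.
move=> z ze.
have -> : psum (fpsC t * fps_exp 1 - 1) z =
    (fun n => t * psum (fps_exp 1) z n - psum 1 z n).
  apply/funext => n; rewrite /psum mulr_sumr -sumrB.
  by apply: eq_bigr => i _; rewrite fpsBE fpsCM0 mulrBl -[in LHS]mulrA.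
apply: tendstoB; last exact: tendsto_psum1.
by apply: tendstoM; [exact: tendsto_cst|exact: He].
Qed.

Lemma bernoulli_fpsE k :
  bernoulli_number R k = k`!%:R * (fps_expm1q R)^-1 k.
Proof.
rewrite /bernoulli_number (egf_coefE (a := (fps_expm1q R)^-1))//.
pose g x := if x == 0 then 1 else (expR x - 1) / x.
have -> : (fun x : R => if x == 0 then 1 else x / (expR x - 1)) =
    (fun x => (g x)^-1).
  by apply/funext => x; rewrite /g; case: ifP => _; rewrite ?invr1// invf_div.
apply: (@expansion_inv _ (@arch_real R) g _ 1).
- exact: fps_expm1q_unit.
- move=> j; rewrite /fps_expm1q normfV normr_nat.
  by rewrite invf_le1 ?ltr0n ?fact_gt0// ler1n fact_gt0.
exists 1 => // x _; rewrite /g; case: eqP => [->|/eqP x0].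
  have -> : psum (fps_expm1q R) 0 = psum 1 0.
    apply/funext => -[|n]; first by rewrite /psum !big_ord0.
    rewrite /psum !big_ord_recl !expr0 !mulr1 /fps_expm1q fps1E invr1.
    by congr (_ + _); apply: eq_bigr => i _; rewrite expr0n /= !mulr0.
  exact: tendsto_psum1.
have -> : psum (fps_expm1q R) x =
   (fun n => (psum (fps_exp 1) x n.+1 - 1) / x).
  apply/funext => n; rewrite /psum big_ord_recl.
  rewrite /fps_exp !expr0 divr1 mulr1 addrAC subrr add0r mulr_suml.
  apply: eq_bigr => i _; rewrite /fps_expm1q expr1n exprS.
  by rewrite div1r [x * _]mulrC mulrA mulfK.
apply: tendstoM; last exact: tendsto_cst.
apply: tendstoB; last exact: tendsto_cst.
have /tendstoP H := @tendsto_expR x; apply/tendstoP => e /H[N HN].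
by exists N => n Nn; exact: HN (leqW Nn).
Qed.

(** The reciprocal formal series has rational coefficients, so that it may be
    taken over the reals or over the complex numbers alike. *)
Lemma G_wcscE j : (G R j)%:C = - fps_wcsc 'i%C (2 * j)%N.
Proof.
rewrite fps_wcscE ?sqr_i//.
have -> : (fps_expm1q R[i])^-1 (2 * j)%N = ((fps_expm1q R)^-1 (2 * j)%N)%:C.
  have mapV : fps_expm1q R[i] * (fun k => ((fps_expm1q R)^-1 k)%:C) = 1.
    apply/funext => n.
    have := congr1 (fun f : fps R => (f n)%:C) (divrr (fps_expm1q_unit R)).
    rewrite !fps1E rmorph_nat => <-.
    rewrite fpsME rmorph_sum; apply: eq_bigr => i _.
    by rewrite rmorphM /fps_expm1q fmorphV rmorph_nat.
  have := congr1 (fun f : fps R[i] => f (2 * j)%N)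
    (mulKr (fps_expm1q_unit R[i]) (fun k => ((fps_expm1q R)^-1 k)%:C)).
  by rewrite mapV mulr1.
rewrite /G bernoulli_fpsE exprM sqr_i.
have pow2 : 2 * (2 ^ ((2 * j)%:Z - 1) - 1) = 2 ^+ (2 * j) - 2 :> R.
  rewrite expfzDr ?pnatr_eq0// exprN1 -exprnP.
  by field.
set B := (fps_expm1q R)^-1 _.
have -> : (-1) ^+ j * 2 * (2 ^ ((2 * j)%:Z - 1) - 1) *
    (((2 * j)`!)%:R * B) / ((2 * j)`!)%:R =
    (-1) ^+ j * (2 * (2 ^ ((2 * j)%:Z - 1) - 1)) * B :> R.
  by field; exact: fact_neq0.
rewrite pow2 !(rmorphM, rmorphB, rmorphXn, rmorphN, rmorph1) /=.
rewrite (rmorph_nat (real_complex R) 2); ring.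
Qed.

End ComplexExp.

(** * Points of the unit circle *)

Section Cis.
Variable R : realType.
Implicit Types (x y : R).

Lemma cisD x y : cis (x + y) = cis x * cis y.
Proof.
by rewrite /cis cosD sinD; apply/eqP; rewrite eq_complex /= eqxx /= [_ + _]addrC.
Qed.

Lemma cis0 : cis (0 : R) = 1.
Proof. by rewrite /cis cos0 sin0. Qed.

Lemma cis_neq0 x : cis x != 0.
Proof.
apply/eqP => c0; have := cisD x (- x).
by rewrite subrr cis0 c0 mul0r => /eqP; rewrite oner_eq0.
Qed.

Lemma cisN x : cis (- x) = (cis x)^-1.
Proof.
by apply: (mulfI (cis_neq0 x)); rewrite -cisD subrr cis0 mulfV// cis_neq0.
Qed.

Lemma cisX x n : cis x ^+ n = cis (x * n%:R).
Proof.
elim: n => [|n IH]; first by rewrite mulr0 cis0.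
by rewrite exprS IH -cisD -natr1; congr cis; ring.
Qed.

Lemma cis_pi : cis (pi : R) = -1.
Proof. by rewrite /cis cospi sinpi; apply/eqP; rewrite eq_complex /= oppr0 !eqxx. Qed.

Lemma cis_cos x : (cis x + (cis x)^-1) / 2 = (cos x)%:C.
Proof.
rewrite -cisN /cis cosN sinN.
have -> : (cos x +i* sin x) + (cos x +i* (- sin x)) = 2 * (cos x)%:C.
  apply/eqP; rewrite -[2](rmorph_nat (real_complex R)) eq_complex /=.
  by apply/andP; split; apply/eqP; ring.
by rewrite mulrC mulKf// pnatr_eq0.
Qed.

Lemma cis_csc x : 2 * 'i%C / (cis x - (cis x)^-1) = (csc x)%:C.
Proof.
rewrite -cisN /cis cosN sinN.
have -> : (cos x +i* sin x) - (cos x +i* (- sin x)) = 2 * 'i%C * (sin x)%:C.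
  apply/eqP; rewrite -[2](rmorph_nat (real_complex R)) eq_complex /=.
  by apply/andP; split; apply/eqP; ring.
rewrite /csc fmorphV invfM mulrA mulfV ?mul1r//.
by rewrite mulf_neq0 ?pnatr_eq0// im_neq0// sqr_i.
Qed.

Lemma cis_sqr_eq1 x : (cis x ^+ 2 == 1) = (sin x == 0).
Proof.
apply/idP/eqP => [|s0].
  rewrite sqrf_eq1 /cis => /orP[]; rewrite eq_complex /= => /andP[_ /eqP//].
  by rewrite oppr0.
have := cos2Dsin2 x; rewrite s0 expr0n addr0 => c1.
have -> : cis x = (cos x)%:C by rewrite /cis s0.
by rewrite -rmorphXn /= c1.
Qed.

Lemma sin_pi_int (k : int) : sin (k%:~R * pi) = 0 :> R.
Proof.
have nat0 n : sin (n%:R * pi) = 0 :> R.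
  elim: n => [|n IH]; first by rewrite mul0r sin0.
  by rewrite -natr1 mulrDl mul1r sinDpi IH oppr0.
case: k => n; first exact: nat0.
by rewrite NegzE mulrNz mulNr sinN nat0 oppr0.
Qed.

Lemma sin_eq0_int x : sin x = 0 -> exists k : int, x = k%:~R * pi.
Proof.
move=> s0; have pi0 := pi_gt0 R.
exists (Num.floor (x / pi)); set k := Num.floor _.
have r_ge0 : 0 <= x - k%:~R * pi.
  by rewrite subr_ge0 -ler_pdivlMr// floor_le_tmp.
have r_lt : x - k%:~R * pi < pi.
  rewrite ltrBlDl -[X in _ + X]mul1r -mulrDl -ltr_pdivrMr//.
  by rewrite -[1](mulr1z 1) -intrD floorD1_gt.
have sr : sin (x - k%:~R * pi) = 0.
  by rewrite sinB s0 sin_pi_int mul0r mulr0 subrr.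
apply/eqP; rewrite -subr_eq0; apply: contraT => r0.
have := @sin_gt0_pi R (x - k%:~R * pi); rewrite sr ltxx lt_def r0 r_ge0 r_lt.
by move=> /(_ isT).
Qed.

Lemma cis_prim_root d : (0 < d)%N -> d.-primitive_root (cis (pi / d%:R : R) ^+ 2).
Proof.
move=> d_gt0; have d0 : (d%:R : R) != 0 by rewrite pnatr_eq0 -lt0n.
have zX k : (cis (pi / d%:R : R) ^+ 2) ^+ k = cis (pi / d%:R * k%:R) ^+ 2.
  by rewrite -!exprM mulnC exprM cisX.
apply/andP; split=> //; apply/forallP => -[i /= id].
rewrite unity_rootE zX cis_sqr_eq1; apply/eqP; apply/eqP/eqP => [s0|->]; last first.
  by rewrite divfK// sinpi.
apply/eqP; rewrite eqn_leq id /= leqNgt; apply/negP => lid.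
have := @sin_gt0_pi R (pi / d%:R * i.+1%:R); rewrite s0 ltxx.
have pi0 := pi_gt0 R.
rewrite mulr_gt0 ?divr_gt0 ?ltr0n//= mulrAC ltr_pdivrMr ?ltr0n//.
by rewrite ltr_pM2l// ltr_nat lid => /(_ isT).
Qed.

Lemma cexp_im x : cexp ('i%C * x%:C) = cis x.
Proof.
have -> : 'i%C * x%:C = 0 +i* x.
  by apply/eqP; rewrite eq_complex /=; apply/andP; split; apply/eqP; ring.
by rewrite /cexp expR0 mul1r.
Qed.

End Cis.

(** * Sums of odd powers of cosecants *)

(* The equation 2 (j_1 + ... + j_(2n-1)) + mu + nu = 2n - 2 forces every index
   below 2n - 1, so ranging over 'I_(2 * n - 1) covers all its solutions. *)
Theorem theorem1p11 (R : realType) (m n d : nat) (b : R)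
    (m_gt0 : (0 < m)%N) (m_odd : odd m) (n_gt0 : (0 < n)%N) (d_gt0 : (0 < d)%N)
    (m_lt_d : (m < d)%N) (hb : forall k : int, b != k%:~R / d%:R) :
  let p1 := cexp (- (pi%:C * 'i%C * m%:R * (b - 1)%:C)) in
  let p2 := cexp (- (2 * pi%:C * 'i%C * d%:R * b%:C)) in
  let p1' := cexp (pi%:C * 'i%C * m%:R * (b - 1)%:C) in
  let p2' := cexp (2 * pi%:C * 'i%C * d%:R * b%:C) in
  (\sum_(0 <= j < d)
     cos (pi * m%:R * j%:R / d%:R)
     * csc (pi * j%:R / d%:R + pi * b) ^+ (2 * n - 1))%:C
  = - \sum_(j : {ffun 'I_(2 * n - 1) -> 'I_(2 * n - 1)})
      \sum_(mu < 2 * n - 1)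
      \sum_(nu < 2 * n - 1
            | (2 * (\sum_r j r) + mu + nu == 2 * n - 2)%N)
        'i%C ^+ (mu + nu + 1) * 2 ^+ nu
        * (m%:R ^+ mu / (mu`!)%:R) * (d%:R ^+ (nu + 1) / (nu`!)%:R)
        * (p1 * A nu p2 - (- 1) ^+ (mu + nu) * p1' * A nu p2')
        * (F R (fun r => j r))%:C.
Proof.
set N := (2 * n - 1)%N.
have N_odd : odd N by rewrite /N; lia.
have NE : (2 * n - 2)%N = N.-1 by rewrite /N; lia.
pose u := cis (pi * b).
have im2 : ('i%C : R[i]) ^+ 2 = -1 := sqr_i R.
have d0 : (d%:R : R) != 0 by rewrite pnatr_eq0 -lt0n.
(* u^(2d) = 1 would make d b an integer. *)
have u2d : u ^+ (2 * d) != 1.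
  rewrite mulnC exprM cisX cis_sqr_eq1; apply/eqP => /sin_eq0_int[k bk].
  move/eqP: (hb k); apply; apply: (mulfI d0); rewrite mulrCA mulfV// mulr1.
  by apply: (mulIf (lt0r_neq0 (pi_gt0 R))); rewrite -bk; ring.
have u2dV : u ^- (2 * d) != 1 by rewrite invr_eq1.
have E1 : 2 * pi%:C * 'i%C * d%:R * b%:C = 'i%C * (pi * b * (2 * d)%:R)%:C.
  by rewrite !(rmorphM, rmorph_nat) /= natrM; ring.
have E2 : pi%:C * 'i%C * m%:R * (b - 1)%:C = 'i%C * (pi * b * m%:R - pi * m%:R)%:C.
  by rewrite !(rmorphM, rmorphB, rmorph_nat, rmorph1) /=; ring.
(* The minus sign is e^(i pi m), for odd m. *)
have p1'E : cexp (pi%:C * 'i%C * m%:R * (b - 1)%:C) = - u ^+ m.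
  rewrite E2 cexp_im cisD cisN -!cisX cis_pi -signr_odd m_odd expr1 invrN invr1.
  by rewrite mulrN1.
have p2'E : cexp (2 * pi%:C * 'i%C * d%:R * b%:C) = u ^+ (2 * d).
  by rewrite E1 cexp_im -cisX.
have p1E : cexp (- (pi%:C * 'i%C * m%:R * (b - 1)%:C)) = - u ^- m.
  by rewrite -invrN -p1'E E2 -mulrN -rmorphN !cexp_im cisN.
have p2E : cexp (- (2 * pi%:C * 'i%C * d%:R * b%:C)) = u ^- (2 * d).
  by rewrite -p2'E E1 -mulrN -rmorphN !cexp_im cisN.
move=> p1 p2 p1' p2'; rewrite /p1 /p2 /p1' /p2' p1E p2E p1'E p2'E NE.
have := @csc_power_sum _ 'i%C im2 N d m (cis (pi / d%:R)) u (fun k => (G R k)%:C)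
  (fun nu => A nu (u ^- (2 * d))) (fun nu => A nu (u ^+ (2 * d)))
  N_odd (cis_prim_root R d_gt0) m_odd m_lt_d (cis_neq0 _) u2d (@G_wcscE R).
move=> /(_ (fun nu => @A_fpsE R _ nu u2dV) (fun nu => @A_fpsE R _ nu u2d)) H.
transitivity (\sum_(j < d)
    (cis (pi / d%:R) ^+ (m * j) + (cis (pi / d%:R) ^+ (m * j))^-1) / 2 *
    (2 * 'i%C / (cis (pi / d%:R) ^+ j * u - (cis (pi / d%:R) ^+ j * u)^-1)) ^+ N).
  rewrite rmorph_sum big_mkord; apply: eq_bigr => j _.
  rewrite rmorphM rmorphXn /= !cisX -cisD cis_cos cis_csc natrM.
  congr ((cos _)%:C * (csc _)%:C ^+ _); ring.
rewrite H; congr (- _); apply: eq_bigr => j _; apply: eq_bigr => mu _.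
apply: eq_bigr => nu _; congr (_ * _).
by rewrite /F rmorph_prod.
Qed.
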